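(* Let $A$ be a finite alphabet with at least two symbols. The conjugacy relation on the standard Borel space of symbolic systems over $A$ with the specification property is not hyperfinite.
   Context: Let $A$ be a finite discrete set (alphabet) and $\sigma\colon A^{\mathbb Z}\to A^{\mathbb Z}$, $\sigma(x)(n)=x(n+1)$, the shift. A symbolic system over $A$ is a nonempty closed set $X\subseteq A^{\mathbb Z}$ with $\sigma(X)=X$, considered with the restriction of $\sigma$. Symbolic systems over $A$ are viewed as elements of the space of nonempty closed subsets of $A^{\mathbb Z}$ with the Vietoris topology; those with the specification property form a Borel subset, hence a standard Borel space. Two systems $(X,\varphi)$, $(Y,\psi)$ are conjugate if there is a homeomorphism $\rho\colon X\to Y$ with $\rho\varphi=\psi\rho$. On symbolic systems over $A$ this is a Borel equivalence relation with countable classes. Specification property: a system $(X,\tau)$ with metric $d$ on $X$ has the specification property if for every $\varepsilon>0$ there is $k\in\mathbb N$ such that for all $n\ge 2$, all $x_1,\dots,x_n\in X$ and all integers $0\le a_1<b_1$, $a_2<b_2,\dots,a_n<b_n$ with $a_i-b_{i-1}\ge k$ for $2\le i\le n$, there is $y\in X$ with $d(\tau^j(x_i),\tau^j(y))\le\varepsilon$ for all $1\le i\le n$ and $a_i\le j<b_i$. A countable Borel equivalence relation on a standard Borel space is hyperfinite if it is an increasing union of a sequence of Borel equivalence relations with finite classes. *)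

(* Defs.v *)
From HB Require Import structures.
From mathcomp Require Import all_boot all_order all_algebra.
From mathcomp Require Import all_classical all_reals all_analysis.

Set Implicit Arguments.
Unset Strict Implicit.
Unset Printing Implicit Defensive.

Import Order.TTheory GRing.Theory Num.Theory.

Local Open Scope classical_set_scope.
Local Open Scope ring_scope.

Section Hyperspace.
Variable T : topologicalType.

Record hyperspace := Hyperspace {
  hset :> set T;
  hset_closed : closed hset;
  hset_nonempty : hset !=set0 }.

HB.instance Definition _ := gen_eqMixin hyperspace.
HB.instance Definition _ := gen_choiceMixin hyperspace.

(* The Vietoris subbase: for U open, [(true, U)] stands for the closed sets
   included in U and [(false, U)] for those meeting U. *)
Definition vietoris_subbase (i : bool * set T) : set hyperspace :=
  if i.1 then [set F : hyperspace | F `<=` i.2]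
  else [set F : hyperspace | F `&` i.2 !=set0].

HB.instance Definition _ := isSubBaseTopological.Build hyperspace
  [set i : bool * set T | open i.2] vietoris_subbase.

End Hyperspace.

Definition borel (T : topologicalType) : set (set T) := <<s @open T >>.

Definition borel_equivalence (T : topologicalType) (E : T -> T -> Prop) : Prop :=
  borel [set p : T * T | E p.1 p.2] /\ RelationClasses.Equivalence E.

Definition hyperfinite (T : topologicalType) (E : T -> T -> Prop) : Prop :=
  exists F : nat -> T -> T -> Prop,
    [/\ forall n, borel_equivalence (F n),
        forall n x, finite_set [set y | F n x y],
        forall n x y, F n x y -> F n.+1 x y
      & forall x y, E x y <-> exists n, F n x y].

(* A system is given by a subset X of an ambient space and a self-map of the
   ambient space, of which only the restriction to X matters. *)
Definition homeomorphism_on (T U : topologicalType) (X : set T) (Y : set U)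
    (rho : T -> U) : Prop :=
  set_bij X Y rho /\ {within X, continuous rho} /\
  exists theta : U -> T,
    {within Y, continuous theta} /\ forall x, X x -> theta (rho x) = x.

Definition conjugate (T U : topologicalType)
    (X : set T) (phi : T -> T) (Y : set U) (psi : U -> U) : Prop :=
  exists rho : T -> U,
    homeomorphism_on X Y rho /\ forall x, X x -> rho (phi x) = psi (rho x).

(* The indices 1, ..., n are shifted to 0, ..., n-1; values of [x], [a], [b] at
   indices >= n are irrelevant. *)
Definition specification (R : realType) (T : Type) (d : T -> T -> R)
    (X : set T) (tau : T -> T) : Prop :=
  forall e : R, 0 < e -> exists k : nat,
    forall (n : nat) (x : nat -> T) (a b : nat -> nat),
      (2 <= n)%N ->
      (forall i, (i < n)%N -> X (x i)) ->
      (forall i, (i < n)%N -> (a i < b i)%N) ->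
      (forall i, (i.+1 < n)%N -> (b i + k <= a i.+1)%N) ->
      exists2 y, X y & forall i j, (i < n)%N -> (a i <= j < b i)%N ->
        d (iter j tau (x i)) (iter j tau y) <= e.

Section Symbolic.
Variables (R : realType) (A : finType).

Definition full_shift : Type :=
  prod_topology (fun _ : int => discrete_topology A).
HB.instance Definition _ := Topological.on full_shift.

Definition shift_map (x : full_shift) : full_shift := fun n => x (n + 1).

(* The usual compatible metric: d(x, y) = 2 ^- min {|n| : x n <> y n} if x <> y,
   and d(x, x) = 0 because [sup set0 = 0]. *)
Definition shift_dist (x y : full_shift) : R :=
  sup [set 2 ^- absz n | n in [set n : int | x n <> y n]].

Definition symbolic_system (X : hyperspace full_shift) : Prop :=
  shift_map @` X = X.

(* As a set of points of the hyperspace, it coerces to a type carrying the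
   subspace topology. *)
Definition spec_systems : set (hyperspace full_shift) :=
  [set X | symbolic_system X /\ specification shift_dist X shift_map].

Definition conjugacy (X Y : spec_systems) : Prop :=
  conjugate (set_val X : hyperspace full_shift) shift_map
            (set_val Y : hyperspace full_shift) shift_map.

End Symbolic.

Arguments spec_systems : clear implicits.
Arguments conjugacy : clear implicits.

(* Main.v *)
Require Import Defs.
From HB Require Import structures.
From mathcomp Require Import all_boot all_order all_algebra.
From mathcomp Require Import perm all_classical all_reals all_analysis.
From mathcomp Require Import zify lra.

(** The group G = Z/2 * Z/2 * Z/2 acts on a probability space, preserving the
    measure and almost everywhere freely, and the space is mapped continuously to
    the systems with specification, injectively on each orbit, in such a way that
    points of one orbit go to conjugate systems. Conjugacy cannot be hyperfinite,
    because the orbit relation of an almost everywhere free action of G that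
    preserves a probability measure is not.

    Fix two symbols a0 <> a1 of A. To every w : nat -> bool is attached the
    shift X_w ([coded w]) of all sequences in which every guarded window spells
    a word whose code k satisfies w k = true. A guarded window begins and ends
    with a1 and contains no run of six a0 ([guarded]), so runs of a0 can be
    used to glue arbitrary pieces of points of X_w: this gives specification
    ([coded_specification]). The map from w to X_w is continuous for the
    Vietoris topology ([coded_system_continuous]), and w is determined by X_w
    on the codes of guarded words ([coded_extend]).

    For each k < 3 there is a local involution [toggle k] of the full shift; it
    maps guarded windows to guarded windows at the same place, hence induces an
    involution [code_perm k] of the codes, and it conjugates X_(w o code_perm k)
    with X_w ([conjugacy_coded]). Inside a guarded window the three involutions
    can push and pop letters of a stack ([stack_word_toggle]), so a nonempty
    reduced word in them moves the codes of infinitely many words, of distinct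
    lengths. Under the fair coin measure on nat -> bool, which is invariant under permutations
    of the coordinates ([coin_measure_permute]), almost every w is therefore
    moved by every nonempty reduced word ([word_act_free],
    [coin_measure_matching0]).

    Suppose conjugacy is an increasing union of finite Borel equivalence
    relations. Pulled back to nat -> bool, one of them, F, would contain each
    edge (w, w o code_perm k) with probability more than 2/3. But every F-class
    inside an orbit has a lexicographically least element, its root; as the orbit
    is a tree, each edge inside the class joins one of its endpoints to the
    neighbour of that endpoint on the way to the root, and for almost every
    point this neighbour is unique. Hence the probabilities of the three kinds
    of edges add up to at most 2 ([sum_edges]), a contradiction. *)

Set Implicit Arguments.
Unset Strict Implicit.
Unset Printing Implicit Defensive.

Import Order.TTheory GRing.Theory Num.Theory.
Import numFieldNormedType.Exports.

Local Open Scope classical_set_scope.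
Local Open Scope ring_scope.

(** * Frames, local involutions and guarded windows *)

Section Patterns.
Variables (A : finType) (a0 a1 : A).
Implicit Types (x y : int -> A) (i j m : int) (k : 'I_3) (e : nat).

(** A frame at [i] is the pattern 1111 0 ??? 0 on the cells [i .. i + 8], where 0
    and 1 stand for [a0] and [a1]. The three free cells [i + 5 .. i + 7] are its
    bits. Two distinct frames cannot overlap, see [frame_apart]. *)
Definition frame x i : bool :=
  [&& x i == a1, x (i + 1) == a1, x (i + 2) == a1, x (i + 3) == a1,
      x (i + 4) == a0 & x (i + 8) == a0].

(** All bits other than the [k]-th one are 0; the value of bit [k] is not
    constrained. *)
Definition low k x i : bool :=
  [forall k' : 'I_3, (k' != k) ==> (x (i + 5 + k'%:Z) == a0)].

(** All three bits are 0. *)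
Definition blank x i : bool := [forall k : 'I_3, x (i + 5 + k%:Z) == a0].

(** The frame at [i] lies between two adjacent frames, the [k]-th bit is its only
    bit that may be nonzero, the next frame is blank and the previous one has a
    nonzero bit other than the [k]-th. In a stack, whose letters are the frames with
    exactly one nonzero bit and whose bottom is a bracket, this singles out a top
    letter [k], or the first free place if the top letter is not [k]. *)
Definition toggled k x i : bool :=
  [&& frame x (i - 9), frame x i, frame x (i + 9),
      ~~ low k x (i - 9), low k x i & blank x (i + 9)].

(** The local involution: exchange [a0] and [a1] in the [k]-th bit of all the
    toggled frames, that is, push or pop the letter [k]. The condition [toggled]
    does not depend on the cells that change, see [toggled_toggle]. *)
Definition toggle k x : int -> A :=
  fun j => if toggled k x (j - 5 - k%:Z) then tperm a0 a1 (x j) else x j.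

(** A frame whose three bits are 1; it is never toggled, nor created or destroyed
    by [toggle]. *)
Definition bracket x i : bool :=
  frame x i && [forall k : 'I_3, x (i + 5 + k%:Z) == a1].

(** A run of six [a0] starting at [i]. *)
Definition zeros x i : bool := [forall o : 'I_6, x (i + o%:Z) == a0].

(** The window [i .. i + e + 9] is guarded: it consists of a bracket at [i], a
    bracket at [i + e] and one more cell [a1], with no bracket strictly between the two
    and no run of six [a0]. *)
Definition guarded x i e : Prop :=
  [/\ (0 < e)%N, bracket x i, bracket x (i + e%:Z), x (i + e%:Z + 9) = a1
    & (forall m, i < m < i + e%:Z -> ~~ bracket x m) /\
      (forall m, i <= m -> m + 6 <= i + e%:Z + 10 -> ~~ zeros x m)].

(** The sequence seen from the position [a]. *)
Definition translate (a : int) x : int -> A := fun n => x (n + a).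

(** The word read in [x] on the [l] cells from [i] on. *)
Definition window x i l : seq A := mkseq (fun o : nat => x (i + o%:Z)) l.

(** The word [p] placed at the position 0 in a sequence of [a0]. *)
Definition extend (p : seq A) : int -> A :=
  fun n => if n is Posz m then nth a0 p m else a0.

(** The words that are read on guarded windows, see [guarded_window]. *)
Definition guarded_word (p : seq A) : Prop :=
  exists2 e : nat, size p = (e + 10)%N & guarded (extend p) 0 e.

(** The action of [toggle k] on words, see [window_toggle]. *)
Definition toggle_word k (p : seq A) : seq A :=
  window (toggle k (extend p)) 0 (size p).

Lemma frame_one x i j : frame x i -> i <= j < i + 4 -> x j = a1.
Proof.
move=> /and5P[/eqP h0 /eqP h1 /eqP h2 /eqP h3 _] ij.
have [->|[->|[->|->]]] // : j = i \/ j = i + 1 \/ j = i + 2 \/ j = i + 3 by lia.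
Qed.

Lemma frame_zero x i j : frame x i -> j = i + 4 \/ j = i + 8 -> x j = a0.
Proof. by move=> /and5P[_ _ _ _ /andP[/eqP h4 /eqP h8]] [->|->]. Qed.

Lemma toggled_frame k x i : toggled k x i -> frame x i.
Proof. by case/and5P. Qed.

Lemma toggle_changed k x j : toggle k x j <> x j ->
  exists2 i, toggled k x i & j = i + 5 + k%:Z.
Proof.
rewrite /toggle; case: ifP => // h _; exists (j - 5 - k%:Z) => //; lia.
Qed.

Lemma toggle_out k x j :
  (forall i, toggled k x i -> j <> i + 5 + k%:Z) -> toggle k x j = x j.
Proof.
move=> h; apply/eqP/negPn/negP => /eqP /toggle_changed[i /h]; exact.
Qed.

Lemma bracket_frame x i : bracket x i -> frame x i.
Proof. by case/andP. Qed.

Lemma frame_local x y i : (forall j, i <= j < i + 9 -> x j = y j) ->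
  frame x i = frame y i.
Proof. by move=> h; rewrite /frame !h //; lia. Qed.

Lemma low_local k x y i : (forall j, i <= j < i + 9 -> x j = y j) ->
  low k x i = low k y i.
Proof.
move=> h; apply/eq_forallb => k'; rewrite h //; have := ltn_ord k'; lia.
Qed.

Lemma bits_local a x y i : (forall j, i <= j < i + 9 -> x j = y j) ->
  [forall k : 'I_3, x (i + 5 + k%:Z) == a] = [forall k : 'I_3, y (i + 5 + k%:Z) == a].
Proof.
move=> h; apply/eq_forallb => k'; rewrite h //; have := ltn_ord k'; lia.
Qed.

Lemma bracket_local x y i : (forall j, i <= j < i + 9 -> x j = y j) ->
  bracket x i = bracket y i.
Proof.
by move=> h; rewrite /bracket (frame_local h) (bits_local _ h).
Qed.

Lemma zeros_local x y i : (forall j, i <= j < i + 6 -> x j = y j) ->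
  zeros x i = zeros y i.
Proof.
move=> h; apply/eq_forallb => k'; rewrite h //; have := ltn_ord k'; lia.
Qed.

Lemma toggled_local k x y i : (forall j, i - 9 <= j < i + 18 -> x j = y j) ->
  toggled k x i = toggled k y i.
Proof.
move=> h.
have h1 j : i - 9 <= j < i - 9 + 9 -> x j = y j by move=> ?; apply: h; lia.
have h2 j : i <= j < i + 9 -> x j = y j by move=> ?; apply: h; lia.
have h3 j : i + 9 <= j < i + 9 + 9 -> x j = y j by move=> ?; apply: h; lia.
rewrite /toggled (frame_local h1) (frame_local h2) (frame_local h3).
by rewrite (low_local k h1) (low_local k h2) /blank (bits_local _ h3).
Qed.

(** Being guarded depends only on the cells of the window. *)
Lemma guarded_local x y i e :
  (forall j, i <= j < i + e%:Z + 10 -> x j = y j) -> guarded x i e -> guarded y i e.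
Proof.
move=> h [e0 b1 b2 x1 [nb nz]]; split=> //.
- rewrite -(@bracket_local x) // => j ?; apply: h; lia.
- rewrite -(@bracket_local x) // => j ?; apply: h; lia.
- by rewrite -h //; lia.
- split=> m.
    move=> mi; rewrite -(@bracket_local x); first exact: nb.
    by move=> j ?; apply: h; lia.
  move=> mi1 mi2; rewrite -(@zeros_local x); first exact: nz.
  by move=> j ?; apply: h; lia.
Qed.

Lemma frame_translate a x i : frame (translate a x) i = frame x (i + a).
Proof. by rewrite /frame /translate !(addrAC i _ a). Qed.

Lemma low_translate a k x i : low k (translate a x) i = low k x (i + a).
Proof. by apply/eq_forallb => k'; rewrite /translate !(addrAC _ _ a). Qed.

Lemma bits_translate (b : A) a x i :
  [forall k : 'I_3, translate a x (i + 5 + k%:Z) == b]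
  = [forall k : 'I_3, x (i + a + 5 + k%:Z) == b].
Proof. by apply/eq_forallb => k'; rewrite /translate !(addrAC _ _ a). Qed.

Lemma bracket_translate a x i : bracket (translate a x) i = bracket x (i + a).
Proof. by rewrite /bracket frame_translate bits_translate. Qed.

Lemma zeros_translate a x i : zeros (translate a x) i = zeros x (i + a).
Proof. by apply/eq_forallb => k'; rewrite /translate !(addrAC _ _ a). Qed.

Lemma toggled_translate k a x i : toggled k (translate a x) i = toggled k x (i + a).
Proof.
by rewrite /toggled !frame_translate !low_translate /blank bits_translate !(addrAC _ _ a).
Qed.

Lemma toggle_translate k a x : toggle k (translate a x) = translate a (toggle k x).
Proof.
by apply/funext => j; rewrite /toggle toggled_translate /translate !(addrAC _ _ a).
Qed.

Lemma guarded_translate a x i e : guarded (translate a x) i e <-> guarded x (i + a) e.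
Proof.
rewrite /guarded !bracket_translate /translate !(addrAC _ _ a).
split=> -[e0 b1 b2 x1 [nb nz]]; split=> //; split=> m.
- move=> ?; have := nb (m - a); rewrite bracket_translate subrK; apply; lia.
- move=> ? ?; have := nz (m - a); rewrite zeros_translate subrK; apply; lia.
- by rewrite bracket_translate => ?; apply: nb; lia.
- by rewrite zeros_translate => ? ?; apply: nz; lia.
Qed.

Lemma window_eq x y i l : (forall j, i <= j < i + l%:Z -> x j = y j) ->
  window x i l = window y i l.
Proof.
by move=> h; apply/eq_in_map => o; rewrite mem_iota => ol; apply: h; lia.
Qed.

Lemma extend_window x i l j : 0 <= j < l%:Z ->
  extend (window x i l) j = translate i x j.
Proof.
by case: j => // m ml; rewrite /= nth_mkseq; [rewrite /translate addrC|lia].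
Qed.

Lemma window_extend p : window (extend p) 0 (size p) = p.
Proof.
rewrite -[RHS](mkseq_nth a0); apply: eq_mkseq => m; by rewrite add0r.
Qed.

Lemma window_translate a x i l : window (translate a x) i l = window x (i + a) l.
Proof. by apply: eq_mkseq => m; rewrite /translate addrAC. Qed.

Lemma guarded_window x i e : guarded x i e <-> guarded_word (window x i (e + 10)).
Proof.
have E j : 0 <= j < 0 + e%:Z + 10 ->
    translate i x j = extend (window x i (e + 10)) j.
  by move=> ?; rewrite extend_window //; lia.
split=> [g|[e']].
  exists e; first by rewrite size_mkseq.
  by apply: (guarded_local E); apply/guarded_translate; rewrite add0r.
rewrite size_mkseq => /addIn <- g; rewrite -(add0r i); apply/guarded_translate.
by apply: guarded_local g => j ?; rewrite E.
Qed.

Lemma size_toggle_word k p : size (toggle_word k p) = size p.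
Proof. by rewrite size_mkseq. Qed.

Hypothesis a01 : a0 != a1.

Lemma frame_apart x i j : frame x i -> frame x j -> i < j -> i + 9 <= j.
Proof.
move=> fi fj ij; rewrite leNgt; apply/negP => ji.
have /eqP[] := a01.
case: (boolP (j <= i + 4)) => h.
  by rewrite -(frame_zero fi (or_introl erefl)); apply: (frame_one fj); lia.
by rewrite -(frame_zero fi (or_intror erefl)); apply: (frame_one fj); lia.
Qed.

Lemma frame_uniq x i j : frame x i -> frame x j -> i < j + 9 -> j < i + 9 -> i = j.
Proof.
move=> fi fj h1 h2; case: (ltgtP i j) => // h.
  by have := frame_apart fi fj h; lia.
by have := frame_apart fj fi h; lia.
Qed.

Lemma frame_toggle_cell k x i o : frame x i -> 0 <= o < 9 -> ~~ (5 <= o < 8) ->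
  toggle k x (i + o) = x (i + o).
Proof.
move=> fi o9 o58; apply: toggle_out => i' /toggled_frame fi' e.
have k3 := ltn_ord k.
by have := frame_uniq fi fi'; lia.
Qed.

Lemma frame_toggle_bit k x i (k' : 'I_3) : frame x i ->
  (k' != k) || ~~ toggled k x i ->
  toggle k x (i + 5 + k'%:Z) = x (i + 5 + k'%:Z).
Proof.
move=> fi h; apply: toggle_out => i' ti' e.
have k3 := ltn_ord k. have k3' := ltn_ord k'.
have ii' : i = i' by apply: (frame_uniq fi (toggled_frame ti')); lia.
move: h; rewrite ii' ti' orbF => /eqP; apply; apply: val_inj => /=; lia.
Qed.

Lemma frame_toggleW k x i : frame x i -> frame (toggle k x) i.
Proof.
move=> fi; have h := frame_toggle_cell k fi.
have := h 0 erefl erefl; rewrite addr0 => h0.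
by have := fi; rewrite /frame h0 !h.
Qed.

(** A new frame at [i] would have to overlap a toggled one, which is still a frame
    after the toggle. *)
Lemma frame_toggle k x i : frame (toggle k x) i = frame x i.
Proof.
apply/idP/idP; last exact: frame_toggleW.
move=> fi; have h o : 0 <= o < 9 -> ~~ (5 <= o < 8) -> toggle k x (i + o) = x (i + o).
  move=> o9 o58; apply: toggle_out => i' /toggled_frame /(frame_toggleW k) fi' e.
  have k3 := ltn_ord k.
  by have := frame_uniq fi fi'; lia.
have := h 0 erefl erefl; rewrite addr0 => h0.
by have := fi; rewrite /frame h0 !h.
Qed.

Lemma low_toggle k x i : frame x i -> low k (toggle k x) i = low k x i.
Proof.
move=> fi; apply/eq_forallb => k'; case: (eqVneq k' k) => //= kk.
by rewrite frame_toggle_bit // kk.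
Qed.

Lemma blank_toggle k x i : frame x i -> ~~ toggled k x i ->
  blank (toggle k x) i = blank x i.
Proof.
by move=> fi nt; apply/eq_forallb => k'; rewrite frame_toggle_bit // nt orbT.
Qed.

Lemma toggled_toggle k x i : toggled k (toggle k x) i = toggled k x i.
Proof.
rewrite /toggled !frame_toggle.
case f1: (frame x (i - 9)) => //=; case f2: (frame x i) => //=.
case f3: (frame x (i + 9)) => //=.
rewrite !low_toggle //; case l1: (low k x (i - 9)) => //=.
case l2: (low k x i) => //=; rewrite blank_toggle //.
by rewrite /toggled addrK l2 /= !andbF.
Qed.

(** [toggle k] is an involution. *)
Lemma toggleK k x : toggle k (toggle k x) = x.
Proof.
apply/funext => j; rewrite {1}/toggle toggled_toggle.
by case: ifP => t; rewrite /toggle t // tpermK.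
Qed.

Lemma bracketNlow k x i : bracket x i -> ~~ low k x i.
Proof.
case/andP=> _ /forallP h; apply/negP => /forallP l.
have [k' kk] : exists k', k' != k.
  by case: (eqVneq k ord0) => [->|n]; [exists ord_max|exists ord0; rewrite eq_sym].
have := l k'; rewrite kk /= (eqP (h k')) eq_sym; exact/negP.
Qed.

Lemma bracketNtoggled k x i : bracket x i -> ~~ toggled k x i.
Proof. by move=> /(bracketNlow k) /negbTE h; rewrite /toggled h /= !andbF. Qed.

Lemma bracket_toggleW k x i : bracket x i -> bracket (toggle k x) i.
Proof.
move=> bi; have nt := bracketNtoggled k bi; have /andP[fi /forallP h] := bi.
rewrite /bracket frame_toggle fi /=; apply/forallP => k'.
by rewrite frame_toggle_bit // nt orbT.
Qed.

Lemma bracket_toggle k x i : bracket (toggle k x) i = bracket x i.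
Proof.
by apply/idP/idP => [/(bracket_toggleW k)|/bracket_toggleW //]; rewrite toggleK.
Qed.

(** A run of six [a0] is never affected: a toggled bit lies between two cells [a1]
    that are only six cells apart. *)
Lemma zeros_toggleW k x i : zeros x i -> zeros (toggle k x) i.
Proof.
move=> /forallP z; apply/forallP => o; rewrite toggle_out //.
have z' j : i <= j < i + 6 -> x j <> a1.
  move=> ij; have o6 : (absz (j - i) < 6)%N by lia.
  have := z (Ordinal o6); rewrite /= (_ : i + _ = j); last by lia.
  by move=> /eqP ->; apply/eqP.
move=> i' /and5P[_ fi' fi9 _ _]; have k3 := ltn_ord k; have o6 := ltn_ord o.
move=> e; case: (boolP (i <= i' + 3)) => h.
  by apply: (z' (i' + 3)); [lia|apply: (frame_one fi'); lia].
by apply: (z' (i' + 9)); [lia|apply: (frame_one fi9); lia].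
Qed.

Lemma zeros_toggle k x i : zeros (toggle k x) i = zeros x i.
Proof.
by apply/idP/idP => [/(zeros_toggleW k)|/zeros_toggleW //]; rewrite toggleK.
Qed.

Lemma guarded_toggle k x i e : guarded x i e -> guarded (toggle k x) i e.
Proof.
case=> e0 b1 b2 x1 [nb nz]; split; rewrite ?bracket_toggle //.
  rewrite toggle_out // => i' /toggled_frame fi' h; have k3 := ltn_ord k.
  by have := frame_uniq (bracket_frame b2) fi'; lia.
by split=> m; [rewrite bracket_toggle; exact: nb|rewrite zeros_toggle; exact: nz].
Qed.

(** Inside a guarded window, [toggle k] depends only on the cells of the window,
    since the brackets at both ends are not toggled and frames do not overlap. *)
Lemma toggle_local k x y i e :
  (forall j, i <= j < i + e%:Z + 10 -> x j = y j) -> guarded x i e ->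
  forall j, i <= j < i + e%:Z + 10 -> toggle k x j = toggle k y j.
Proof.
move=> h gx j ij; have gy := guarded_local h gx; have k3 := ltn_ord k.
have inner z : guarded z i e -> toggled k z (j - 5 - k%:Z) ->
    i <= j - 5 - k%:Z - 9 /\ j - 5 - k%:Z + 18 <= i + e%:Z + 10.
  move=> [_ b1 b2 _ _]; set i' := j - _ - _ => ti.
  have n1 : i' <> i by move=> /esym E; have := bracketNtoggled k b1; rewrite E ti.
  have n2 : i' <> i + e%:Z.
    by move=> /esym E; have := bracketNtoggled k b2; rewrite E ti.
  have u1 := frame_uniq (toggled_frame ti) (bracket_frame b1).
  have u2 := frame_uniq (toggled_frame ti) (bracket_frame b2).
  by rewrite /i' in n1 n2 u1 u2 *; lia.
rewrite /toggle (h _ ij).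
suff -> : toggled k x (j - 5 - k%:Z) = toggled k y (j - 5 - k%:Z) by [].
apply/idP/idP => t.
  have [? ?] := inner _ gx t; rewrite -(@toggled_local k x) // => m ?; apply: h; lia.
have [? ?] := inner _ gy t; rewrite (@toggled_local k x y) // => m ?; apply: h; lia.
Qed.

Lemma window_toggle k x i e : guarded x i e ->
  window (toggle k x) i (e + 10) = toggle_word k (window x i (e + 10)).
Proof.
move=> g; have g' : guarded (translate i x) 0 e by apply/guarded_translate; rewrite add0r.
rewrite -{1}(add0r i) -window_translate -toggle_translate /toggle_word size_mkseq.
apply: window_eq => j ?; apply: (toggle_local k _ g'); last by lia.
by move=> m ?; rewrite extend_window //; lia.
Qed.

Lemma guarded_toggle_word k p : guarded_word p -> guarded_word (toggle_word k p).
Proof.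
move=> [e sp g]; rewrite /toggle_word sp; apply/guarded_window; exact: guarded_toggle.
Qed.

Lemma toggle_wordK k p : guarded_word p -> toggle_word k (toggle_word k p) = p.
Proof.
move=> [e sp g].
rewrite [in LHS]/toggle_word -/(toggle_word k p) {2}/toggle_word size_toggle_word.
have := window_toggle k (guarded_toggle k g).
by rewrite toggleK -sp window_extend {1}/toggle_word size_mkseq => <-.
Qed.

(** A guarded word has no other guarded window than itself. *)
Lemma guarded_extend p i e : guarded_word p -> guarded (extend p) i e ->
  window (extend p) i (e + 10) = p.
Proof.
move=> [e' sp [_ b1 b2 x1 [nb nz]]] [e0 b1' b2' x1' [nb' nz']].
rewrite add0r in b2 x1.
have dom j : extend p j = a1 -> 0 <= j < e'%:Z + 10.
  case: j => [m|m] /=; last by move=> /eqP; rewrite (negbTE a01).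
  case: (ltnP m (size p)) => [|h]; first by lia.
  by rewrite nth_default // => /eqP; rewrite (negbTE a01).
have at_bracket j : bracket (extend p) j -> j = 0 \/ j = e'.
  move=> bj; have fj := bracket_frame bj.
  have d0 := dom _ (frame_one fj (_ : j <= j < j + 4)).
  have d3 := dom _ (frame_one fj (_ : j <= j + 3 < j + 4)).
  case: (eqVneq j 0) => [|j0]; first by left.
  case: (eqVneq j e'%:Z) => [|je]; first by right.
  have := frame_uniq fj (bracket_frame b2).
  case: (ltP j e'%:Z) => h.
    by have := nb j; rewrite bj add0r; lia.
  by lia.
have [i0|ie] := at_bracket _ b1'; last first.
  by have [h|h] := at_bracket _ b2'; move: h e0; rewrite ie; lia.
have [h|h] := at_bracket _ b2'; first by lia.
have -> : e = e' by lia.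
by rewrite i0 -sp window_extend.
Qed.

(** The [k]-th bit of the block [b] among the blocks [0 .. n + 1], where the first and
    the last blocks are brackets and the blocks [1 .. n] hold the letters of [w]
    followed by blank frames. The default value 3 of [nth] differs from every bit
    number. *)
Definition stack_bit (w : seq 'I_3) (n b k : nat) : bool :=
  [|| b == 0%N, b == n.+1 | nth 3 (map val w) b.-1 == k].

(** The cell number [r] of the block number [b]. *)
Definition stack_cell (w : seq 'I_3) (n b r : nat) : A :=
  if (r < 4)%N || ((5 <= r < 8)%N && stack_bit w n b (r - 5)) then a1 else a0.

(** The bi-infinite sequence with the [n + 2] blocks above from the position 0 on,
    one final cell [a1], and [a0] everywhere else. *)
Definition stack (w : seq 'I_3) (n : nat) : int -> A := fun z =>
  if z is Posz m then
    if m == (9 * n.+2)%N then a1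
    else if (m < 9 * n.+2)%N then stack_cell w n (m %/ 9) (m %% 9) else a0
  else a0.

Lemma stackE w n b r : (b <= n.+1)%N -> (r < 9)%N ->
  stack w n (9 * b + r)%N = stack_cell w n b r.
Proof.
move=> bn r9; rewrite /stack.
have -> : (9 * b + r == 9 * n.+2)%N = false by lia.
have -> : (9 * b + r < 9 * n.+2)%N by lia.
by rewrite mulnC divnMDl // divn_small // addn0 modnMDl modn_small.
Qed.

Lemma stackEz w n (b r : nat) (z : int) : (b <= n.+1)%N -> (r < 9)%N ->
  z = (9 * b + r)%:Z -> stack w n z = stack_cell w n b r.
Proof. by move=> bn r9 ->; exact: stackE. Qed.

Lemma stack_frame w n (b : nat) : (b <= n.+1)%N -> frame (stack w n) (9 * b)%:Z.
Proof.
move=> bn; have h r : (r < 9)%N ->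
    stack w n ((9 * b)%:Z + r%:Z) = stack_cell w n b r.
  by move=> r9; apply: stackEz.
have := h 0%N erefl; rewrite addr0 => h0.
rewrite /frame h0 (h 1%N) // (h 2%N) // (h 3%N) // (h 4%N) // (h 8%N) //.
by rewrite /stack_cell /= !eqxx.
Qed.

Lemma stack_at_bit w n b k : (b <= n.+1)%N ->
  (stack w n ((9 * b)%:Z + 5 + k%:Z) == a1) = stack_bit w n b k.
Proof.
move=> bn; have k3 := ltn_ord k; rewrite (@stackEz _ _ b (5 + k)) //; try lia.
rewrite /stack_cell; have -> : (5 + k < 4)%N = false by lia.
have -> : (5 <= 5 + k < 8)%N by lia.
rewrite addKn /=; case: ifP => _; first by rewrite eqxx.
exact: negbTE.
Qed.

Lemma stack_at_bit0 w n b k : (b <= n.+1)%N ->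
  (stack w n ((9 * b)%:Z + 5 + k%:Z) == a0) = ~~ stack_bit w n b k.
Proof.
move=> bn; have k3 := ltn_ord k; rewrite (@stackEz _ _ b (5 + k)) //; try lia.
rewrite /stack_cell; have -> : (5 + k < 4)%N = false by lia.
have -> : (5 <= 5 + k < 8)%N by lia.
rewrite addKn /=; case: ifP => _; last by rewrite eqxx.
by apply: negbTE; rewrite eq_sym.
Qed.

Lemma stack_dom w n z : stack w n z = a1 -> 0 <= z <= (9 * n.+2)%:Z.
Proof.
case: z => [m|m] /=; last by move=> /eqP; rewrite (negbTE a01).
case: eqP => [->|_]; first by lia.
by case: ifP => [|_ /eqP]; [lia|rewrite (negbTE a01)].
Qed.

Lemma stack_frame_inv w n i : frame (stack w n) i ->
  exists2 b : nat, (b <= n.+1)%N & i = (9 * b)%:Z.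
Proof.
move=> fi.
have d0 := stack_dom (frame_one fi (_ : i <= i < i + 4)).
have d3 := stack_dom (frame_one fi (_ : i <= i + 3 < i + 4)).
have bn : (absz i %/ 9 <= n.+1)%N by lia.
exists (absz i %/ 9)%N => //.
by apply: (frame_uniq fi (stack_frame w bn)); lia.
Qed.

Lemma stack_bracket w n b : (b <= n.+1)%N ->
  bracket (stack w n) (9 * b)%:Z = (b == 0%N) || (b == n.+1).
Proof.
move=> bn; rewrite /bracket stack_frame //=; apply/forallP/idP => [h|h k].
  apply/negPn/negP => nb; have := h ord0; have := h ord_max.
  rewrite !stack_at_bit // /stack_bit; rewrite !orbA (negbTE nb) /=.
  by move=> /eqP ->.
by rewrite stack_at_bit // /stack_bit orbA h.
Qed.

Lemma stack_guarded w n : guarded (stack w n) 0 (9 * n.+1).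
Proof.
have b0 : bracket (stack w n) 0 by have := @stack_bracket w n 0%N erefl => ->.
have b1 : bracket (stack w n) (9 * n.+1)%:Z by rewrite stack_bracket ?eqxx ?orbT.
split=> //; rewrite ?add0r //.
- rewrite (_ : _ + 9 = (9 * n.+2)%:Z); last by lia.
  by rewrite /= eqxx.
- split=> m.
    move=> mn; apply/negP => bm; have [b bn mE] := stack_frame_inv (bracket_frame bm).
    by move: bm; rewrite mE stack_bracket //; lia.
  case: m => // m _ mn; apply/negP => /forallP z.
  have z' (o : nat) : (o < 6)%N -> stack w n (m + o)%N <> a1.
    move=> o6; have := z (Ordinal o6) => /eqP /= ->; exact/eqP.
  case: (ltnP (m %% 9)%N 4) => h.
    apply: (z' 0%N) => //; rewrite (@stackEz _ _ (m %/ 9)%N (m %% 9)%N) //; try lia.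
    by rewrite /stack_cell h.
  apply: (z' (9 - m %% 9)%N); first by lia.
  case: (eqVneq (m %/ 9)%N n.+1) => E.
    by rewrite /stack ifT //; lia.
  by rewrite (@stackEz _ _ (m %/ 9).+1%N 0%N) //; lia.
Qed.

(** The guarded word encoding the stack [w] with [n] places. *)
Definition stack_word (w : seq 'I_3) n : seq A := window (stack w n) 0 (9 * n.+1 + 10).

Lemma stack_word_guarded w n : guarded_word (stack_word w n).
Proof. by apply/guarded_window; exact: stack_guarded. Qed.

Lemma stack_bit_inner w n b (r : nat) : (0 < b <= n)%N ->
  stack_bit w n b r = (nth 3 (map val w) b.-1 == r).
Proof.
move=> bn; rewrite /stack_bit (_ : (b == 0%N) = false); last by lia.
by rewrite (_ : (b == n.+1) = false); last by lia.
Qed.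

Lemma low_stack k w n b : (b <= n.+1)%N ->
  low k (stack w n) (9 * b)%:Z = [forall k' : 'I_3, (k' != k) ==> ~~ stack_bit w n b k'].
Proof. by move=> bn; apply/eq_forallb => k'; rewrite stack_at_bit0. Qed.

Lemma blank_stack w n b : (0 < b)%N -> (size w < b <= n)%N ->
  blank (stack w n) (9 * b)%:Z.
Proof.
move=> b0 bn; have h : (size w <= b.-1)%N by lia.
apply/forallP => k; rewrite stack_at_bit0; last by lia.
rewrite stack_bit_inner; last by lia.
rewrite nth_default ?size_map //.
by have := ltn_ord k; lia.
Qed.

Lemma nth_letter (w : seq 'I_3) b : (b < size w)%N ->
  exists s : 'I_3, nth 3 (map val w) b = s.
Proof. by move=> bw; exists (nth ord0 w b); rewrite (nth_map ord0). Qed.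

(** If the top of the stack is not [k], the only toggled frame is the first free
    one. *)
Lemma stack_toggled k (w : seq 'I_3) n i : ((size w).+1 < n)%N ->
  nth 3 (map val w) (size w).-1 != k ->
  toggled k (stack w n) i = (i == (9 * (size w).+1)%:Z).
Proof.
move=> wn wk; apply/idP/eqP => [|->].
  case/and5P => f1 f2 f3 l1 /andP[l2 b3].
  have [b bn iE] := stack_frame_inv f2; rewrite iE in f1 f2 f3 l1 l2 b3 *.
  have [b' bn' b'E] := stack_frame_inv f1; have [b'' bn'' b''E] := stack_frame_inv f3.
  have b1 : b = b'.+1 by lia.
  have b2 : b'' = b.+1 by lia.
  subst b b''.
  rewrite (_ : _ - 9 = (9 * b')%:Z) in l1; last by lia.
  rewrite (_ : _ + 9 = (9 * b'.+2)%:Z) in b3; last by lia.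
  congr (9 * _.+1)%:Z; apply/eqP; rewrite eqn_leq; apply/andP; split; rewrite leqNgt; apply/negP.
    move=> h; have h' : (size w <= b'.-1)%N by lia.
    case/negP: l1; rewrite low_stack //; apply/forallP => k'; apply/implyP => _.
    rewrite stack_bit_inner; last by lia.
    rewrite nth_default ?size_map //.
    by have := ltn_ord k'; lia.
  move=> h; have [s sE] := nth_letter h.
  move: l2; rewrite low_stack // => /forallP /(_ s); rewrite stack_bit_inner ?sE ?eqxx; last by lia.
  rewrite implybF negbK => /eqP sk; subst s.
  case: (ltnP b'.+1 (size w)) => h'; last first.
    by move: wk; rewrite (_ : (size w).-1 = b') ?sE ?eqxx; lia.
  have [s sE'] := nth_letter h'.
  by move: b3 => /forallP /(_ s); rewrite stack_at_bit0 // stack_bit_inner ?sE' ?eqxx //; lia.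
have F b : (b <= n.+1)%N -> frame (stack w n) (9 * b)%:Z by exact: stack_frame.
rewrite /toggled (_ : _ - 9 = (9 * size w)%:Z); last by lia.
rewrite (_ : _ + 9 = (9 * (size w).+2)%:Z); last by lia.
rewrite !F; try lia.
rewrite blank_stack; try lia.
rewrite !low_stack; try lia.
rewrite andbT /=; apply/andP; split; last first.
  apply/forallP => k'; apply/implyP => _; rewrite stack_bit_inner; last by lia.
  rewrite nth_default ?size_map //.
  by have := ltn_ord k'; lia.
case: (posnP (size w)) => w0.
  apply/negP => /forallP l.
  have [k' kk] : exists k', k' != k.
    by case: (eqVneq k ord0) => [->|nk]; [exists ord_max|exists ord0; rewrite eq_sym].
  by have := l k'; rewrite kk w0 /stack_bit eqxx.
have [|s sE] := @nth_letter w (size w).-1; first by lia.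
rewrite sE in wk.
apply/negP => /forallP /(_ s); rewrite (_ : s != k) //=.
by rewrite stack_bit_inner ?sE ?eqxx //; lia.
Qed.

Lemma stack_toggle k (w : seq 'I_3) n : ((size w).+1 < n)%N ->
  nth 3 (map val w) (size w).-1 != k ->
  toggle k (stack w n) = stack (rcons w k) n.
Proof.
move=> wn wk; apply/funext => j; rewrite /toggle stack_toggled //.
have k3 := ltn_ord k.
have bit_rcons b r : stack_bit (rcons w k) n b r =
    if b == (size w).+1 then r == k else stack_bit w n b r.
  rewrite /stack_bit map_rcons nth_rcons size_map.
  case: (eqVneq b (size w).+1) => [->|bw].
    have nw : (size w == n) = false by lia.
    by rewrite [_.-1]/= ltnn eqxx eqSS nw /= eq_sym.
  case: (eqVneq b 0%N) => //= b0; case: ltnP => // h; rewrite ifF; last by lia.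
  by rewrite nth_default ?size_map.
case: j => [m|m]; last by rewrite ifF //; lia.
rewrite /= ; case: (m =P (9 * n.+2)%N) => [->|m1].
  by rewrite ifF //; lia.
case: (ltnP m (9 * n.+2)%N) => m2; last by rewrite ifF //; lia.
have dm := divn_eq m 9; have rm : (m %% 9 < 9)%N by rewrite ltn_mod.
rewrite /stack_cell bit_rcons.
case: (eqVneq (m %/ 9)%N (size w).+1) => E; last by rewrite ifF //; lia.
have nb r : (r < 3)%N -> stack_bit w n (size w).+1 r = false.
  by move=> r3; rewrite stack_bit_inner ?nth_default ?size_map //; lia.
case: (ltnP (m %% 9)%N 4) => r4 /=; first by rewrite ifF //; lia.
case: (boolP (5 <= m %% 9 < 8)%N) => r5 /=; last by rewrite ifF //; lia.
rewrite E nb; last by lia.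
case: (eqVneq (m %% 9 - 5)%N k) => Ek; last by rewrite ifF //; lia.
by rewrite ifT ?tpermL //; lia.
Qed.

(** Pushing a letter that differs from the top of the stack. *)
Lemma stack_word_toggle k (w : seq 'I_3) n : ((size w).+1 < n)%N ->
  nth 3 (map val w) (size w).-1 != k ->
  toggle_word k (stack_word w n) = stack_word (rcons w k) n.
Proof.
move=> h1 h2; rewrite /stack_word -window_toggle; last exact: stack_guarded.
by rewrite stack_toggle.
Qed.

Lemma stack_word_neq k (w : seq 'I_3) n : (0 < n)%N -> stack_word (k :: w) n <> stack_word [::] n.
Proof.
move=> n0 /(congr1 (fun p => extend p ((9 * 1)%:Z + 5 + k%:Z))).
have k3 := ltn_ord k.
rewrite !extend_window; try lia.
rewrite /translate addr0 => /(congr1 (fun c => c == a1)).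
rewrite !stack_at_bit // !stack_bit_inner //= eqxx; lia.
Qed.

End Patterns.

(** * The fair coin measure on nat -> bool *)

Lemma pow2_small (R : realType) (e : R) : 0 < e -> exists n, 2 ^- n <= e.
Proof.
move=> e0; have h : `|2^-1 : R| < 1 by rewrite gtr0_norm; lra.
have /cvgrPdist_le/(_ _ e0)[n _ /(_ n (leqnn _))] := cvg_geometric 1 h.
rewrite /= /geometric /= sub0r normrN mul1r exprVn => en; exists n.
exact: le_trans (ler_norm _) en.
Qed.

(** Neighbourhoods in a product of discrete spaces are given by finitely many
    coordinates. *)
Lemma nbhs_prod_discrete (I : eqType) (T : I -> topologicalType)
    (disc : forall i (t : T i), nbhs t [set t]) (x : prod_topology T)
    (U : set (prod_topology T)) :
  nbhs x U <-> exists s : seq I, [set y : prod_topology T | forall i, i \in s -> y i = x i] `<=` U.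
Proof.
split=> [|[s sU]].
  pose F := filter_from [set: seq I]
    (fun s => [set y : prod_topology T | forall i, i \in s -> y i = x i]).
  have FF : Filter F.
    apply: filter_from_filter; first by exists [::].
    move=> s t _ _; exists (s ++ t) => // y h.
    by split=> i it; apply: h; rewrite mem_cat it ?orbT.
  have Fx : F --> x.
    apply/cvg_sup => i V [?/= [[W oW <-]]] /= Wx /filterS; apply.
    by exists [:: i] => // y /= /(_ i); rewrite mem_head /= => ->.
  by move=> /Fx [s _ sU]; exists s.
have FF : Filter (nbhs x) by exact: nbhs_filter.
suff h : nbhs x [set y : prod_topology T | forall i, i \in s -> y i = x i].
  exact: (@filterS _ _ FF _ _ sU h).
elim: s {sU} => [|i s ih]; first by apply: (@filterS _ _ FF setT) => //; exact: (@filterT _ _ FF).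
have h := @proj_continuous I T i x _ (disc i (x i)).
apply: (@filterS _ _ FF _ _ _ (@filterI _ _ FF _ _ h ih)) => y /= [yi ys] j.
by rewrite inE => /orP[/eqP -> //|]; exact: ys.
Qed.

Lemma nbhs_bool (b : bool) : nbhs b [set b].
Proof. by rewrite nbhs_principalE; apply/principal_filterP. Qed.

(** The cylinder of the sequences whose first [n] terms are those of [v]. *)
Definition agree (n : nat) (v : nat -> bool) : set cantor_space :=
  [set w | forall k, (k < n)%N -> w k = v k].

Lemma nbhs_cantor (v : cantor_space) (U : set cantor_space) :
  nbhs v U <-> exists n, agree n v `<=` U.
Proof.
split.
  move=> /nbhs_prod_discrete[|s sU]; first by move=> _; exact: nbhs_bool.
  exists (\max_(k <- s) k).+1 => w wv; apply: sU => k ks; apply: wv; rewrite ltnS.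
  exact: leq_bigmax_seq.
move=> [n nU]; apply/nbhs_prod_discrete; first by move=> _; exact: nbhs_bool.
by exists (iota 0 n) => w wv; apply: nU => k kn; apply: wv; rewrite mem_iota.
Qed.

Lemma open_agree n v : open (agree n v).
Proof.
rewrite openE => w wv; apply/nbhs_cantor; exists n => u uw k kn.
by rewrite uw // wv.
Qed.

(** Sequences of coin tosses with the Borel sets of the Cantor space as measurable
    sets. *)
Definition coins : Type := g_sigma_algebraType (@open cantor_space).
HB.instance Definition _ := Measurable.on coins.

Lemma measurable_coinsE : (@measurable _ coins) = <<s @open cantor_space >>.
Proof. by []. Qed.

(** The empty set is added to obtain a pi-system. *)
Definition cylinders : set (set cantor_space) :=
  [set B | B = set0 \/ exists n v, B = agree n v].

Lemma cylinders_setI : setI_closed cylinders.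
Proof.
move=> B C [->|[n [v ->]]]; first by rewrite set0I; left.
case=> [->|[m [u ->]]]; first by rewrite setI0; left.
wlog nm : n m v u / (n <= m)%N.
  by case: (leqP n m) => [nm /(_ n m)|/ltnW mn /(_ m n)]; [exact|rewrite setIC; exact].
have [[w [wv wu]]|] := pselect (agree n v `&` agree m u !=set0); last first.
  by move=> /set0P/negP/negPn/eqP ->; left.
right; exists m, u; apply/seteqP; split=> [x []//|x xu]; split=> // k kn.
by rewrite xu ?(leq_trans kn) // -wu ?wv // (leq_trans kn).
Qed.

Lemma open_cylinders : <<s @open cantor_space >> = <<s cylinders >>.
Proof.
apply/seteqP; split; apply: smallest_sub; try exact: smallest_sigma_algebra.
  move=> U oU.
  (* Cylinders are indexed by finite words, to write [U] as a countable union. *)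
  pose code k : cantor_space := fun i => nth false (odflt [::] (unpickle k)) i.
  pose D k n := if `[< agree n (code k) `<=` U >] then agree n (code k) else set0.
  have -> : U = \bigcup_n \bigcup_k D k n.
    apply/seteqP; split=> [w Uw|w [n _ [k _]]]; last first.
      by rewrite /D; case: ifP => // /asboolP; apply.
    have [n nU] : exists n, agree n w `<=` U.
      by apply/nbhs_cantor; exact: open_nbhs_nbhs.
    exists n => //; exists (pickle (mkseq w n)) => //.
    have E : agree n (code (pickle (mkseq w n))) = agree n w.
      by apply/seteqP; split=> u uw k kn; rewrite uw // /code pickleK /= nth_mkseq.
    by rewrite /D E; case: ifP => [//|/asboolP].
  apply: (@sigma_algebra_bigcup _ setT cylinders) => n.
  apply: (@sigma_algebra_bigcup _ setT cylinders) => k.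
  apply: sub_sigma_algebra; rewrite /D; case: ifP => _; last by left.
  by right; exists n, (code k).
move=> B [->|[n [v ->]]]; first exact: sigma_algebra0.
by apply: sub_sigma_algebra; exact: open_agree.
Qed.

Section CoinMeasure.
Variable R : realType.

(** The greedy binary expansion of [t]: [approx t n] is the sum of its first [n]
    digits with their weights. *)
Fixpoint approx (t : R) (n : nat) : R :=
  if n is m.+1 then
    let a := approx t m in if a + 2 ^- n <= t then a + 2 ^- n else a
  else 0.

(** The digit [n] is 1 if the weight [2 ^- n.+1] still fits. *)
Definition digits (t : R) : coins := fun n => approx t n + 2 ^- n.+1 <= t.

(** The left end of the dyadic interval of the numbers whose first [n] digits are
    those of [v]. *)
Fixpoint lower (v : nat -> bool) (n : nat) : R :=
  if n is m.+1 then if v m then lower v m + 2 ^- n else lower v m else 0.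

Lemma approx_agree v n t : agree n v (digits t) -> approx t n = lower v n.
Proof.
elim: n => //= n ih h; rewrite -(h n) // /digits ih //.
by move=> k kn; apply: h; exact: ltnW.
Qed.

Lemma digits_agree v n t :
  (0 <= t < 1 /\ agree n v (digits t)) <->
  (lower v n <= t < lower v n + 2 ^- n).
Proof.
elim: n => [|n ih].
  by rewrite /= expr0 invr1 add0r; split=> [[]//|]; split.
have p : (2 : R) ^- n.+1 > 0 by rewrite invr_gt0 exprn_gt0.
have e : (2 : R) ^- n = 2 ^- n.+1 + 2 ^- n.+1.
  by rewrite exprS invfM -mulrDl -(mul1r (2 ^- n)); congr (_ * _); lra.
have lowerS : lower v n.+1 = if v n then lower v n + 2 ^- n.+1 else lower v n by [].
have dn : digits t n = (approx t n + 2 ^- n.+1 <= t) by [].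
move: p e lowerS dn ih; move: (2 ^- n.+1) (2 ^- n) => q r p -> lowerS dn ih.
rewrite lowerS; split=> [[t01 h]|].
  have hn : agree n v (digits t) by move=> k kn; apply: h; exact: ltnW.
  have /andP[] := (ih.1 (conj t01 hn)).
  rewrite -(h n) // dn (@approx_agree v) //.
  by case: (leP (lower v n + q) t) => ? ? ?; apply/andP; split; lra.
move=> /andP[h1 h2].
have hn : lower v n <= t < lower v n + (q + q).
  by move: h1 h2; case: (v n) => ? ?; apply/andP; split; lra.
have [t01 hn'] := ih.2 hn; split=> // k; rewrite ltnS leq_eqVlt.
move=> /orP[/eqP ->|/hn' //].
rewrite dn (@approx_agree v) //; move: h1 h2.
by case: (v n); case: leP => //; lra.
Qed.

Lemma measurable_digits_agree n v :
  measurable ((@digits @^-1` agree n v) : set R).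
Proof.
elim: n => [|n ih].
  by rewrite (_ : _ @^-1` _ = setT) //; apply/seteqP; split.
pose a := lower v n + 2 ^- n.+1.
have -> : @digits @^-1` agree n.+1 v = @digits @^-1` agree n v `&`
    (if v n then [set` `[a, +oo[%R] else [set` `]-oo, a[%R]).
  apply/seteqP; split=> t /=.
    move=> h; have hn : agree n v (digits t) by move=> k kn; apply: h; exact: ltnW.
    split=> //; rewrite -(h n) // /digits (@approx_agree v) // -/a.
    by case: leP => /= ?; rewrite in_itv /= ?andbT.
  move=> [hn ht] k; rewrite ltnS leq_eqVlt => /orP[/eqP ->|/hn //].
  rewrite /digits (@approx_agree v) // -/a; move: ht.
  by case: (v n) => /=; rewrite in_itv /= ?andbT => ?; [|apply/negbTE; rewrite -ltNge].
by apply: measurableI => //; case: (v n); exact: measurable_itv.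
Qed.

Lemma measurable_digits : measurable_fun [set: R] (@digits).
Proof.
apply: (@measurability _ _ _ coins _ _ cylinders).
  by rewrite -open_cylinders.
move=> _ [B [->|[n [v ->]]] <-]; rewrite setTI ?preimage_set0 //.
exact: measurable_digits_agree.
Qed.

(** The fair coin measure: the image of the Lebesgue measure of the unit interval
    under the binary expansion. *)
Definition coin_measure (B : set coins) : \bar R :=
  lebesgue_measure (@digits @^-1` B `&` [set` `[0, 1[%R]).

Let coin_measure0 : coin_measure set0 = 0%E.
Proof. by rewrite /coin_measure preimage_set0 set0I measure0. Qed.

Let coin_measure_ge0 B : (0 <= coin_measure B)%E.
Proof. exact: measure_ge0. Qed.

Let coin_measure_sigma_additive : semi_sigma_additive coin_measure.
Proof.
move=> F mF tF mUF; rewrite /coin_measure preimage_bigcup setI_bigcupl.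
apply: measure_semi_sigma_additive.
- move=> n; apply: measurableI; last exact: measurable_itv.
  by rewrite -[X in measurable X]setTI; exact: measurable_digits.
- apply/trivIsetP => /= i j _ _ ij; rewrite setIACA -preimage_setI.
  by move/trivIsetP : tF => /(_ _ _ _ _ ij) ->//; rewrite preimage_set0 set0I.
- rewrite -setI_bigcupl -preimage_bigcup.
  apply: measurableI; last exact: measurable_itv.
  by rewrite -[X in measurable X]setTI; exact: measurable_digits.
Qed.

HB.instance Definition _ := isMeasure.Build _ _ _
  coin_measure coin_measure0 coin_measure_ge0 coin_measure_sigma_additive.

Lemma coin_measure_agree n v : coin_measure (agree n v) = (2 ^- n)%:E.
Proof.
rewrite /coin_measure.
have -> : @digits @^-1` agree n v `&` [set` `[0, 1[%R]
    = [set` `[lower v n, lower v n + 2 ^- n[%R].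
  apply/seteqP; split=> t; rewrite /= !in_itv /=.
    by move=> [h1 h2]; apply/digits_agree.
  by move=> /digits_agree[].
rewrite lebesgue_measure_itv /= lte_fin ltrDl invr_gt0 exprn_gt0 //.
by rewrite -EFinB addrAC subrr add0r.
Qed.

Let coin_measureT : coin_measure setT = 1%E.
Proof.
have <- : agree 0 (fun=> true) = setT by apply/seteqP; split.
by rewrite coin_measure_agree expr0 invr1.
Qed.

HB.instance Definition _ :=
  Measure_isProbability.Build _ _ _ coin_measure coin_measureT.

End CoinMeasure.

(** The cylinder prescribing the coordinates in [s]. *)
Definition cyl (s : seq nat) (v : nat -> bool) : set coins :=
  [set w | forall k, k \in s -> w k = v k].

Definition update (v : nat -> bool) (k : nat) (b : bool) : nat -> bool :=
  fun i => if i == k then b else v i.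

Lemma measurable_coord k b : measurable [set w : coins | w k = b].
Proof.
apply: sub_sigma_algebra => /=; rewrite openE => w /= wk; apply/nbhs_cantor.
by exists k.+1 => u /= ->.
Qed.

Lemma measurable_cyl s v : measurable (cyl s v).
Proof.
elim: s => [|k s ih].
  by rewrite (_ : cyl _ _ = setT) //; apply/seteqP; split.
have -> : cyl (k :: s) v = [set w : coins | w k = v k] `&` cyl s v.
  apply/seteqP; split=> w /=.
    by move=> h; split=> [|i si]; apply: h; rewrite inE ?eqxx ?si ?orbT.
  by move=> [wk ws] i; rewrite inE => /orP[/eqP ->|/ws].
apply: measurableI => //; exact: measurable_coord.
Qed.

Lemma cyl_cons k s v b : k \notin s ->
  cyl (k :: s) (update v k b) = cyl s v `&` [set w | w k = b].
Proof.
move=> ks; apply/seteqP; split=> w /=.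
  move=> h; split; last by rewrite h ?mem_head // /update eqxx.
  move=> i si; rewrite h ?inE ?si ?orbT // /update ifF //.
  by apply: contraNF ks => /eqP <-.
move=> [ws wk] i; rewrite inE /update; case: eqP => [-> //|_]; exact: ws.
Qed.

Lemma measurable_matching (p q : nat -> nat) m :
  measurable [set w : coins | forall j, (j < m)%N -> w (p j) = w (q j)].
Proof.
elim: m => [|n mn].
  by rewrite (_ : mkset _ = setT) //; apply/seteqP; split.
rewrite (_ : mkset _ = [set w : coins | forall j, (j < n)%N -> w (p j) = w (q j)] `&`
   (([set w : coins| w (p n) = true] `&` [set w : coins | w (q n) = true]) `|`
   ([set w : coins| w (p n) = false] `&` [set w : coins | w (q n) = false]))).
  by repeat (apply: measurableI => // || apply: measurableU => // || exact: measurable_coord).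
apply/seteqP; split=> w /=.
  move=> h; split=> [j jn|]; first by apply: h; exact: ltnW.
  by rewrite (h n) //; case: (w (q n)); [left|right].
move=> [h hn] j; rewrite ltnS leq_eqVlt => /orP[/eqP ->|/h //].
by move: hn => [] [-> ->].
Qed.

Section CoinMeasureTheory.
Variable R : realType.
Let mu : probability coins R := coin_measure R.

Lemma half_add (n : nat) : ((2 : R) ^- n.+1)%:E + (2 ^- n.+1)%:E = (2 ^- n)%:E :> \bar R.
Proof.
rewrite -EFinD; congr EFin; rewrite exprS invfM -mulrDl -[RHS]mul1r.
by congr (_ * _); lra.
Qed.

Lemma measure_coord (B : set coins) k : measurable B ->
  (mu B = mu (B `&` [set w | w k = true]) + mu (B `&` [set w | w k = false]))%E.
Proof.
move=> mB; rewrite -measureU.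
- congr (mu _); apply/seteqP; split=> w /= => [Bw|[[]|[]]//].
  by case: (w k); [left|right].
- by apply: measurableI => //; exact: measurable_coord.
- by apply: measurableI => //; exact: measurable_coord.
- by apply/seteqP; split=> w //= [[_ ->] []].
Qed.

(** Prescribing [size s] coordinates has probability [2 ^- size s]: this holds for
    the initial segments, and each coordinate that is missing for an initial segment
    can be added by splitting along its two values. *)
Lemma mu_cyl s v : uniq s -> mu (cyl s v) = (2 ^- size s)%:E.
Proof.
move=> us; have [n sn] : exists n, forall k, k \in s -> (k < n)%N.
  by exists (\max_(k <- s) k).+1 => k ks; rewrite ltnS; exact: leq_bigmax_seq.
have sizen t : uniq t -> (forall k, k \in t -> (k < n)%N) -> (size t <= n)%N.
  move=> ut tn; rewrite -[X in (_ <= X)%N](size_iota 0); apply: uniq_leq_size => //.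
  by move=> k /tn; rewrite mem_iota.
move dE : (n - size s)%N => d; elim: d s v us sn dE => [|d ih] s v us sn dE.
  have sE : size s = n by have := sizen s us sn; lia.
  have sub : {subset s <= iota 0 n} by move=> k /sn; rewrite mem_iota.
  have [|_ h] := uniq_min_size us sub; first by rewrite size_iota sE.
  rewrite sE -(coin_measure_agree R n v); congr (mu _).
  apply/seteqP; split=> w wv k.
    by move=> kn; apply: wv; rewrite h mem_iota.
  by move=> /sn; exact: wv.
have [k kn ks] : exists2 k, (k < n)%N & k \notin s.
  apply: contrapT => h.
  have : (size (iota 0 n) <= size s)%N.
    apply: uniq_leq_size; first exact: iota_uniq.
    move=> k; rewrite mem_iota => kn; apply/negPn/negP => ks; apply: h; by exists k.
  by rewrite size_iota; lia.
rewrite (measure_coord k (measurable_cyl s v)) -!cyl_cons // !ih /= ?ks //.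
- exact: half_add.
- by move=> i; rewrite inE => /orP[/eqP ->|/sn].
- by rewrite /= subnS dE.
- by move=> i; rewrite inE => /orP[/eqP ->|/sn].
- by rewrite /= subnS dE.
Qed.

(** The events that two coordinates agree are independent, of probability 1/2, for
    disjoint pairs of coordinates. *)
Lemma mu_matching (p q : nat -> nat) m s v :
    injective p -> injective q -> (forall i j, p i <> q j) ->
    uniq s -> (forall j, (j < m)%N -> p j \notin s /\ q j \notin s) ->
  mu (cyl s v `&` [set w | forall j, (j < m)%N -> w (p j) = w (q j)])
  = (2 ^- (size s + m))%:E.
Proof.
move=> pi qi pq; elim: m s v => [|m ih] s v us ds.
  rewrite addn0 -(mu_cyl v us); congr (mu _); apply/seteqP.
  by split=> w /= => [[]//|]; split.
have [pm qm] := ds m (leqnn _).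
rewrite (@measure_coord _ (p m)); last first.
  by apply: measurableI; [exact: measurable_cyl|exact: measurable_matching].
(* Split along the common value [b] of the coordinates [p m] and [q m]. *)
pose t b := update (update v (q m) b) (p m) b.
have E b : (cyl s v `&` [set w | forall j, (j < m.+1)%N -> w (p j) = w (q j)])
     `&` [set w | w (p m) = b]
   = cyl (p m :: q m :: s) (t b) `&` [set w | forall j, (j < m)%N -> w (p j) = w (q j)].
  rewrite cyl_cons ?inE ?negb_or ?pm ?andbT; last by apply/eqP.
  rewrite cyl_cons //; apply/seteqP; split=> w /=.
    move=> [[h1 h2] h3]; repeat split => //; first by rewrite -h2.
    by move=> j jm; apply: h2; exact: ltnW.
  move=> [[[h1 h2] h3] h4]; repeat split => //.
  by move=> j; rewrite ltnS leq_eqVlt => /orP[/eqP ->|/h4 //]; rewrite h2.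
have us' : uniq (p m :: q m :: s).
  by rewrite /= inE negb_or pm qm us !andbT; apply/eqP.
have ds' j : (j < m)%N -> p j \notin p m :: q m :: s /\ q j \notin p m :: q m :: s.
  move=> jm; have [pj qj] := ds j (ltnW jm).
  have jm' : j <> m by move=> E'; rewrite E' ltnn in jm.
  have h1 : p j != p m by apply/eqP => /pi.
  have h2 : p j != q m by apply/eqP.
  have h3 : q j != p m by apply/eqP => /esym; exact: pq.
  have h4 : q j != q m by apply/eqP => /qi.
  by rewrite !inE !negb_or pj qj h1 h2 h3 h4.
by rewrite !E !ih //= !addSn addnS half_add.
Qed.

Lemma measurable_permute (f : nat -> nat) :
  measurable_fun [set: coins] (fun w : coins => w \o f : coins).
Proof.
apply: (@measurability _ _ coins coins _ _ cylinders).
  by rewrite -open_cylinders.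
move=> _ [B [->|[n [v ->]]] <-]; rewrite setTI ?preimage_set0 //.
elim: n => [|n ih].
  by rewrite (_ : _ @^-1` _ = setT) //; apply/seteqP; split.
rewrite (_ : _ @^-1` _ = ((fun w : coins => w \o f : coins) @^-1` agree n v) `&`
    [set w : coins | w (f n) = v n]).
  by apply: measurableI => //; exact: measurable_coord.
apply/seteqP; split=> w /=.
  by move=> h; split=> [j jn|]; apply: h => //; exact: ltnW.
by move=> [h hn] j; rewrite ltnS leq_eqVlt => /orP[/eqP ->|/h //].
Qed.

(** The coin measure is invariant under permutations of the coordinates. Injectivity
    of [f] suffices, since the values on the coordinates outside its range are not
    used. *)
Lemma coin_measure_permute (f : nat -> nat) (B : set coins) :
  injective f -> measurable B -> mu [set w : coins | B (w \o f)] = mu B.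
Proof.
move=> fi mB; pose m2 : {measure set coins -> \bar R} :=
  measure_function_pushforward__canonical__measure_function_Measure
    mu (measurable_permute f).
rewrite -[LHS]/(m2 B); apply/esym.
apply: (@measure_unique _ R coins cylinders (fun=> setT) _ _ _ _ mu m2) => //.
- by rewrite measurable_coinsE open_cylinders.
- exact: cylinders_setI.
- by move=> _; right; exists 0%N, (fun=> true); apply/seteqP; split.
- by rewrite bigcup_const.
- move=> _ [->|[n [v ->]]]; first by rewrite !measure0.
  rewrite [LHS]coin_measure_agree; apply/esym.
  have [g gf] : exists g : nat -> nat, cancel f g.
    exists (fun k => if pselect (exists i, f i = k) is left h then sval (cid h) else 0%N).
    move=> k; case: pselect => [h|[]]; last by exists k.
    by apply: fi; exact: (svalP (cid h)).
  have := @mu_cyl (map f (iota 0 n)) (v \o g).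
  rewrite map_inj_uniq // iota_uniq size_map size_iota => <- //.
  congr (mu _); apply/seteqP; split=> w /=.
    by move=> h k /mapP[i]; rewrite mem_iota => im ->; rewrite /= gf -h.
  move=> h k kn; rewrite /= h ?mem_map ?mem_iota //= ?gf //.
- by move=> k; rewrite (le_lt_trans (probability_le1 mu measurableT)) ?ltry.
Qed.

Lemma coin_measure_matching0 (p q : nat -> nat) :
    injective p -> injective q -> (forall i j, p i <> q j) ->
  mu.-negligible [set w : coins | forall j, w (p j) = w (q j)].
Proof.
move=> pi qi pq; pose E m := [set w : coins | forall j, (j < m)%N -> w (p j) = w (q j)].
have mE m : measurable (E m) by exact: measurable_matching.
exists (\bigcap_m E m); split; first exact: bigcapT_measurable.
  apply/eqP; rewrite eq_le measure_ge0 andbT; apply/lee_addgt0Pr => e e0.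
  rewrite add0e.
  have [m me] := pow2_small e0.
  apply: (@le_trans _ _ (mu (E m))).
    apply: le_measure; rewrite ?inE //; first exact: bigcapT_measurable.
    exact: bigcap_inf.
  have := @mu_matching p q m [::] (fun=> true) pi qi pq isT (fun _ _ => conj isT isT).
  rewrite (_ : cyl _ _ = setT) ?setTI; last by apply/seteqP; split.
  by rewrite add0n /E => ->; rewrite lee_fin.
by move=> w h m _ j _; exact: h.
Qed.

End CoinMeasureTheory.

(** * Actions of Z/2 * Z/2 * Z/2 by permutations of the coin tosses *)

(** The lexicographic order on sequences of coin tosses. *)
Definition lexle (u v : coins) : Prop :=
  forall n, (forall m, (m < n)%N -> u m = v m) -> u n ==> v n.

Lemma lexle_refl u : lexle u u.
Proof. by move=> n _; exact: implybb. Qed.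

Lemma lexle_anti u v : lexle u v -> lexle v u -> u = v.
Proof.
move=> uv vu; apply/funext; apply: (well_founded_induction Wf_nat.lt_wf) => n h.
have h' m : (m < n)%N -> u m = v m by move=> mn; apply: h; lia.
have := uv n h'; have := vu n (fun m mn => esym (h' m mn)).
by case: (u n); case: (v n).
Qed.

Lemma lexle_trans v u w : lexle u v -> lexle v w -> lexle u w.
Proof.
move=> uv vw n h.
have uvE : forall m, (m < n)%N -> u m = v m.
  apply: (well_founded_induction Wf_nat.lt_wf) => m ih mn.
  have h' i : (i < m)%N -> u i = v i by move=> im; apply: ih; lia.
  have := uv m h'; have := vw m (fun i im => etrans (esym (h' i im)) (h i (ltn_trans im mn))).
  by rewrite -(h m mn); case: (u m); case: (v m).
have := uv n uvE; have := vw n (fun i im => etrans (esym (uvE i im)) (h i im)).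
by case: (u n); case: (v n); case: (w n).
Qed.

Lemma lexle_total u v : lexle u v \/ lexle v u.
Proof.
have [|h] := pselect (lexle u v); first by left.
right; move: h => /existsNP[n /not_implyP[h /negP]]; rewrite negb_imply => /andP[un vn] m h'.
case: (ltngtP n m) => nm.
- by have := h' n nm; rewrite un (negbTE vn).
- by rewrite h // implybb.
- by rewrite -nm (negbTE vn).
Qed.

Lemma finite_lexle_min (C : set coins) : finite_set C -> C !=set0 ->
  exists2 u, C u & forall v, C v -> lexle u v.
Proof.
move=> /finite_seqP[s ->]; elim: s => [|x s ih] [y /= ys]; first by [].
case: s => [|z s] in ih ys *.
  exists x; first by rewrite /= mem_head.
  by move=> v /=; rewrite inE => /eqP ->; exact: lexle_refl.
have [|u us uP] := ih; first by exists z; rewrite /= mem_head.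
have [xu|ux] := lexle_total x u.
  exists x; first by rewrite /= mem_head.
  move=> v /=; rewrite inE => /orP[/eqP ->|/uP]; first exact: lexle_refl.
  exact: lexle_trans.
exists u; first by rewrite /= inE us orbT.
by move=> v /=; rewrite inE => /orP[/eqP -> //|/uP].
Qed.

Lemma measurable_exists d (S : measurableType d) (T : countType) (P : T -> set S) :
  (forall t, measurable (P t)) -> measurable [set w | exists t, P t w].
Proof.
move=> mP; rewrite (_ : mkset _ = \bigcup_n (oapp P set0 (unpickle n))).
  by apply: bigcupT_measurable => n; case: unpickle => //=.
apply/seteqP; split=> [w [t Pt]|w [n _]]; first by exists (pickle t); rewrite //= pickleK.
by case: unpickle => //= t Pt; exists t.
Qed.

Lemma measurable_forall d (S : measurableType d) (T : countType) (P : T -> set S) :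
  (forall t, measurable (P t)) -> measurable [set w | forall t, P t w].
Proof.
move=> mP; rewrite (_ : mkset _ = ~` [set w | exists t, (~` P t) w]).
  by apply: measurableC; apply: measurable_exists => t; exact: measurableC.
apply/seteqP; split=> w /=; first by move=> h [t]; apply; exact: h.
by move=> h t; apply: contrapT => n; apply: h; exists t.
Qed.

Lemma negligible_exists d (S : measurableType d) (R : realType)
    (mu : {measure set S -> \bar R}) (T : countType) (P : T -> set S) :
  (forall t, mu.-negligible (P t)) -> mu.-negligible [set w | exists t, P t w].
Proof.
move=> mP; rewrite (_ : mkset _ = \bigcup_n (oapp P set0 (unpickle n))).
  by apply: negligible_bigcup => n; case: unpickle => //=; exact: negligible_set0.
apply/seteqP; split=> [w [t Pt]|w [n _]]; first by exists (pickle t); rewrite //= pickleK.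
by case: unpickle => //= t Pt; exists t.
Qed.

Section InvolutionAction.
Variables (R : realType) (f : 'I_3 -> nat -> nat).
Hypothesis fK : forall s, involutive (f s).
Let mu : probability coins R := coin_measure R.
Implicit Types (w v : seq 'I_3) (s : 'I_3) (x y : coins).

(** The action of a word in three involutions: [s] acts by permuting the coordinates
    along [f s], and the last letter of the word acts first. *)
Definition word_act w x : coins := foldr (fun s (y : coins) => y \o f s) x w.

(** The permutation of the coordinates underlying [word_act w]. *)
Definition word_index w (k : nat) : nat := foldl (fun k s => f s k) k w.

(** Adjacent letters are distinct: the normal form of the elements of
    Z/2 * Z/2 * Z/2. *)
Definition reduced w := sorted (fun s t => s != t) w.

Lemma word_actE w x : word_act w x = x \o word_index w.
Proof.
apply/funext => k; elim: w k => //= s w ih k; by rewrite /= ih.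
Qed.

Lemma word_act_cat w v x : word_act (w ++ v) x = word_act w (word_act v x).
Proof. by rewrite /word_act foldr_cat. Qed.

Lemma word_actK1 s x : word_act [:: s; s] x = x.
Proof. by apply/funext => k /=; rewrite fK. Qed.

Lemma word_act_revK w x : word_act (rev w) (word_act w x) = x.
Proof.
elim: w x => // s w ih x; rewrite rev_cons -cats1 word_act_cat -[RHS]ih; congr word_act.
exact: word_actK1.
Qed.

Lemma word_index_inj w : injective (word_index w).
Proof. by elim: w => [|s w ih] i j //= /ih /(inv_inj (fK s)). Qed.

Lemma reduce_word v : exists2 w, reduced w & forall x, word_act w x = word_act v x.
Proof.
elim: v => [|s v [w rw wv]]; first by exists [::].
case: w rw wv => [|t w] rw wv; first by exists [:: s] => // x /=; rewrite -wv.
case: (eqVneq s t) => [st|st].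
  exists w; first exact: path_sorted rw.
  move=> x; rewrite /= -wv -st; exact/esym/(word_actK1 s).
exists (s :: t :: w); first by rewrite /reduced /= st.
by move=> x; rewrite [RHS]/= -wv.
Qed.

Lemma reduced_rev w : reduced (rev w) = reduced w.
Proof. by rewrite /reduced rev_sorted; apply: eq_sorted => s t; rewrite eq_sym. Qed.

(** Two distinct reduced words that agree at [x] yield a nonempty reduced word that
    fixes [x]: cancel the common prefix, then move one word to the other side. *)
Lemma word_act_eq w v x : reduced w -> reduced v -> w <> v ->
  word_act w x = word_act v x ->
  exists u, [/\ reduced u, u <> [::] & word_act u x = x].
Proof.
elim: w v => [|s w ih] v rw rv wv e.
  by exists v; split => // h; apply: wv.
case: v rv wv e => [|t v] rv wv e; first by exists (s :: w); split.
case: (eqVneq s t) => [st|st].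
  apply: (ih v); [exact: path_sorted rw|exact: path_sorted rv| |].
    by move=> h; apply: wv; rewrite st h.
  move: e; rewrite -st => /(congr1 (word_act [:: s])) e.
  have : word_act [:: s; s] (word_act w x) = word_act [:: s; s] (word_act v x) := e.
  by rewrite !word_actK1.
exists (rev (s :: w) ++ t :: v); split.
- rewrite /reduced; move: rw rv; rewrite -reduced_rev /reduced rev_cons.
  case: (rev w) => [|a u] /=; first by move=> _ ->; rewrite st.
  by rewrite cat_path rcons_path last_rcons /= => -> ->; rewrite st.
- by case: (rev _).
- by rewrite word_act_cat -e word_act_revK.
Qed.

Lemma measurable_word_act w (B : set coins) : measurable B ->
  measurable [set x | B (word_act w x)].
Proof.
move=> mB.
rewrite [X in measurable X](_ : _ = (fun x : coins => x \o word_index w : coins) @^-1` B).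
  by rewrite -[X in measurable X]setTI; exact: measurable_permute.
by apply/seteqP; split=> x /=; rewrite word_actE.
Qed.

Lemma measure_word_act w (B : set coins) : measurable B ->
  mu [set x | B (word_act w x)] = mu B.
Proof.
move=> mB; rewrite -(coin_measure_permute R (@word_index_inj w) mB); congr (mu _).
by apply/seteqP; split=> x /=; rewrite word_actE.
Qed.

Lemma measurable_lexle w : measurable [set x | lexle x (word_act w x)].
Proof.
rewrite [X in measurable X](_ : _ = [set x | forall n : nat,
    (exists m : nat, ((m < n)%N /\ x m <> x (word_index w m))) \/
    (x n = false \/ x (word_index w n) = true)]).
  apply: (@measurable_forall _ coins) => n; apply: measurableU; last first.
    by apply: measurableU; exact: measurable_coord.
  apply: (@measurable_exists _ coins) => m.
  case: (ltnP m n) => mn; last first.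
    by rewrite [X in measurable X](_ : _ = set0) //; apply/seteqP; split=> x // [].
  rewrite [X in measurable X](_ : _ =
     ([set x : coins | x m = true] `&` [set x : coins | x (word_index w m) = false]) `|`
     ([set x : coins | x m = false] `&` [set x : coins | x (word_index w m) = true])).
    by apply: measurableU; apply: measurableI; exact: measurable_coord.
  apply/seteqP; split=> x /=.
    by move=> [_]; case: (x m); case: (x (word_index w m)) => //; [left|right].
  by move=> [[-> ->]|[-> ->]].
apply/seteqP; split=> x /=; rewrite word_actE => h n.
  have [e|ne] := pselect (forall m, (m < n)%N -> x m = (x \o word_index w) m).
    have /= := h n e; case: (x n) => /=; last by right; left.
    by right; right.
  by left; move: ne => /existsNP[m /not_implyP[mn ne]]; exists m.
move=> e; case: (h n) => [[m [mn]]|]; first by rewrite e.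
by move=> [->|/= ->] //; rewrite implybT.
Qed.

Hypothesis free : forall w, reduced w -> w <> [::] ->
  mu.-negligible [set x | word_act w x = x].

Section FiniteRelation.
Variable F : coins -> coins -> Prop.
Hypothesis Feq : RelationClasses.Equivalence F.
Hypothesis Fmeas : forall w, measurable [set x | F x (word_act w x)].
Hypothesis Ffin : forall x, finite_set [set y | F x y /\ exists w, y = word_act w x].

Let Frefl x : F x x. Proof. exact: RelationClasses.Equivalence_Reflexive. Qed.
Let Fsym x y : F x y -> F y x. Proof. exact: RelationClasses.Equivalence_Symmetric. Qed.
Let Ftrans y x z : F x y -> F y z -> F x z.
Proof. exact: RelationClasses.Equivalence_Transitive. Qed.

(** [x] is the lexicographically least point of its orbit that is [F]-related to
    it. *)
Definition is_root x := forall w, F x (word_act w x) -> lexle x (word_act w x).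

(** The word [w] leads from [x] to the root of the class of [x]. *)
Definition to_root w : set coins := [set x | F x (word_act w x) /\ is_root (word_act w x)].

(** The first step from [x] towards the root of its class is [s]. As words act from
    the right, the first step is the last letter. *)
Definition parent s : set coins :=
  [set x | exists w, reduced (rcons w s) /\ to_root (rcons w s) x].

Lemma measurable_root : measurable [set x | is_root x].
Proof.
apply: (@measurable_forall _ coins) => w.
rewrite [X in measurable X](_ : _ =
    (~` [set x | F x (word_act w x)]) `|` [set x | lexle x (word_act w x)]).
  by apply: measurableU; [exact: measurableC|exact: measurable_lexle].
apply/seteqP; split=> x /= h; last by case: h.
by have [|] := pselect (F x (word_act w x)); [right; exact: h|left].
Qed.

Lemma measurable_parent s : measurable (parent s).
Proof.
apply: (@measurable_exists _ coins) => w.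
case: (reduced _); last first.
  by rewrite [X in measurable X](_ : _ = set0) //; apply/seteqP; split=> x // [].
rewrite [X in measurable X](_ : _ = to_root (rcons w s)); last by apply/seteqP; split=> x // [].
by apply: measurableI; [exact: Fmeas|exact: (measurable_word_act _ measurable_root)].
Qed.

Lemma exists_root x : exists2 w, reduced w & to_root w x.
Proof.
have [|y [Fxy [v yv]] ymin] := finite_lexle_min (Ffin x).
  by exists x; split => //; exists [::].
have [w rw wv] := reduce_word v.
exists w => //; rewrite /to_root /= wv -yv; split=> // u Fyu; apply: ymin.
by split; [exact: Ftrans Fyu|exists (u ++ v); rewrite word_act_cat yv].
Qed.

Lemma root_uniq w v x : to_root w x -> to_root v x -> word_act w x = word_act v x.
Proof.
move=> [Fw rw] [Fv rv].
have Fwv : F (word_act w x) (word_act v x) by exact: Ftrans (Fsym Fw) Fv.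
have wE : word_act w x = word_act (w ++ rev v) (word_act v x).
  by rewrite word_act_cat word_act_revK.
have vE : word_act v x = word_act (v ++ rev w) (word_act w x).
  by rewrite word_act_cat word_act_revK.
apply: lexle_anti.
  by rewrite vE; apply: rw; rewrite -vE.
by rewrite wE; apply: rv; rewrite -wE; exact: Fsym.
Qed.

(** Of the two ends of an edge inside a class, one is on the way of the other to the
    root. *)
Lemma edge_parent s x : F x (word_act [:: s] x) ->
  parent s x \/ parent s (word_act [:: s] x).
Proof.
move=> Fs; have [w rw [Fw Rw]] := exists_root x.
case: (lastP w) rw Fw Rw => [|v t] rw Fw Rw.
  have E : word_act (rcons [::] s) (word_act [:: s] x) = x by exact: word_actK1.
  by right; exists [::]; split => //; rewrite /to_root /mkset E; split=> //; exact: Fsym.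
case: (eqVneq t s) => [ts|ts]; first by left; exists v; rewrite -ts.
right; exists (rcons v t); split.
  move: rw; rewrite /reduced; case: v {Fw Rw} => [|a v] /= rw; first by rewrite ts.
  by rewrite rcons_path rw last_rcons.
have E : word_act (rcons (rcons v t) s) (word_act [:: s] x) = word_act (rcons v t) x.
  by rewrite -cats1 word_act_cat; congr word_act; exact: word_actK1.
by rewrite /to_root /mkset E; split => //; exact: Ftrans (Fsym Fs) Fw.
Qed.

(** By freeness the first step towards the root is almost everywhere unique. *)
Lemma negligible_parentI s t : s <> t -> mu.-negligible (parent s `&` parent t).
Proof.
move=> st.
apply: (@negligibleS _ _ _ mu [set x | exists w, reduced w /\ w <> [::] /\ word_act w x = x]).
  move=> x [[w [rw tw]] [v [rv tv]]].
  have wv : rcons w s <> rcons v t.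
    by move=> /(congr1 (last s)); rewrite !last_rcons.
  by have [u [ru un ux]] := word_act_eq rw rv wv (root_uniq tw tv); exists u.
apply: (@negligible_exists _ coins) => w.
case: (pselect (reduced w /\ w <> [::])) => [[rw wn]|n].
  by apply: negligibleS (free rw wn) => x [_ []].
by apply: negligibleS (negligible_set0 _) => x [? []] ? ?; apply: n.
Qed.

Lemma sum_parent : (\sum_(s < 3) mu (parent s) <= 1)%E.
Proof.
have [Z [mZ Z0 sZ]] : mu.-negligible [set x | exists p : 'I_3 * 'I_3,
    p.1 <> p.2 /\ (parent p.1 `&` parent p.2) x].
  apply: (@negligible_exists _ coins) => p.
  have [pp|pp] := pselect (p.1 <> p.2).
    by apply: negligibleS (negligible_parentI pp) => x [].
  by apply: negligibleS (negligible_set0 _) => x [].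
(* Off a null set the three sets are disjoint. *)
pose D s := parent s `\` Z.
have mD s : measurable (D s) by apply: measurableD => //; exact: measurable_parent.
have DE s : mu (parent s) = mu (D s).
  rewrite (measureDI _ (measurable_parent s) mZ) [X in (_ + X)%E](_ : _ = 0%E) ?adde0 //.
  apply: (subset_measure0 _ mZ _ Z0); last by move=> x [].
  by apply: measurableI => //; exact: measurable_parent.
under eq_bigr do rewrite DE.
rewrite -measure_bigsetU_ord //.
  by apply: probability_le1; exact: bigsetU_measurable.
apply/trivIsetP => s t _ _ /eqP st; apply/seteqP; split=> // x [[xs xZ] [xt _]].
by apply: xZ; apply: sZ; exists (s, t).
Qed.

(** An edge labelled [s] inside a class is accounted for by one of its ends, and the
    action of [s] preserves the measure. *)
Lemma sum_edges : (\sum_(s < 3) mu [set x | F x (word_act [:: s] x)] <= 2%:E)%E.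
Proof.
have h s : (mu [set x | F x (word_act [:: s] x)] <= mu (parent s) + mu (parent s))%E.
  rewrite -{2}(measure_word_act [:: s] (measurable_parent s)).
  have mp := measurable_parent s.
  have mp' := measurable_word_act [:: s] mp.
  apply: le_trans (measureU2 _ mp mp').
  apply: le_measure; rewrite ?inE; [exact: Fmeas|exact: measurableU|].
  by move=> x; exact: edge_parent.
apply: (le_trans (lee_sum _ (fun s _ => h s))).
by rewrite big_split /= [X in (_ <= X)%E](_ : _ = (1 + 1)%E) ?leeD ?sum_parent //.
Qed.

End FiniteRelation.

(** An almost everywhere free action of Z/2 * Z/2 * Z/2 by permutations of the coin
    tosses is not contained in an increasing union of measurable equivalence
    relations with finite classes in each orbit. *)
Theorem action_not_hyperfinite (F : nat -> coins -> coins -> Prop) :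
  (forall n, RelationClasses.Equivalence (F n)) ->
  (forall n w, measurable [set x | F n x (word_act w x)]) ->
  (forall n x, finite_set [set y | F n x y /\ exists w, y = word_act w x]) ->
  (forall n x y, F n x y -> F n.+1 x y) ->
  (forall s x, exists n, F n x (word_act [:: s] x)) -> False.
Proof.
move=> Feq Fm Ff Fs Fu.
have Fmono m n x y : (m <= n)%N -> F m x y -> F n x y.
  by move=> /subnK <- h; elim: (n - m)%N => // k ih; rewrite addSn; exact: Fs.
(* The points all of whose edges are in [F n]; their measure tends to 1, but by
   [sum_edges] it is at most 2/3. *)
pose B n : set coins := [set x | forall s, F n x (word_act [:: s] x)].
have mB n : measurable (B n) by apply: (@measurable_forall _ coins) => s; exact: Fm.
have BT : \bigcup_n B n = setT.
  apply/seteqP; split=> // x _.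
  have /choice[N hN] := fun s => Fu s x.
  exists (\max_(s < 3) N s)%N => // s.
  by apply: (Fmono (N s)) => //; exact: leq_bigmax.
have B23 n : (mu (B n) <= (2 / 3)%:E)%E.
  have BF s : (mu (B n) <= mu [set x | F n x (word_act [:: s] x)])%E.
    by apply: le_measure; rewrite ?inE //; move=> x; apply.
  have := le_trans (lee_sum _ (fun s _ => BF s)) (sum_edges (Feq n) (Fm n) (Ff n)).
  rewrite !big_ord_recl big_ord0 adde0.
  rewrite -(fineK (fin_num_measure mu (B n) (mB n))) -!EFinD !lee_fin => ?.
  by lra.
have cB : mu \o B @ \oo --> mu setT.
  rewrite -BT; apply: nondecreasing_cvg_mu => //; first by rewrite BT.
  by move=> m n mn; apply/subsetPset => x h s; exact: Fmono (h s).
have : (mu setT <= (2 / 3)%:E)%E.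
  rewrite -(cvg_lim _ cB) //; apply: lime_le; first by apply/cvg_ex; exists (mu setT).
  by apply: nearW => n; exact: B23.
by rewrite probability_setT lee_fin; lra.
Qed.

End InvolutionAction.

(** * Shifts coded by sequences of coin tosses *)

Section CodedShift.
Variables (R : realType) (A : finType) (a0 a1 : A).
Hypothesis a01 : a0 != a1.
Local Notation shift_space := (full_shift A).
Local Notation guarded := (guarded a0 a1).
Local Notation toggle := (toggle a0 a1).
Implicit Types (x y : shift_space) (w : coins).

(** The sequences that agree with [x] on the cells of absolute value less than
    [N]. *)
Definition agree_on (N : nat) x : set shift_space :=
  [set y | forall j : int, (absz j < N)%N -> y j = x j].

Lemma nbhs_shift x (U : set shift_space) :
  nbhs x U <-> exists N, agree_on N x `<=` U.
Proof.
have disc (i : int) (t : discrete_topology A) : nbhs t [set t].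
  by rewrite nbhs_principalE; apply/principal_filterP.
split.
  move=> /(@nbhs_prod_discrete _ (fun=> discrete_topology A)) [//|s sU].
  exists (\max_(k <- s) absz k).+1 => y yx; apply: sU => k ks; apply: yx; rewrite ltnS.
  exact: (@leq_bigmax_seq _ s predT absz).
move=> [N NU]; apply/(@nbhs_prod_discrete _ (fun=> discrete_topology A)) => //.
exists [seq k%:Z - N%:Z | k <- iota 0 (2 * N)] => y yx; apply: NU => j jN; apply: yx.
apply/mapP; exists (absz (j + N%:Z)); [rewrite mem_iota; lia|lia].
Qed.

Lemma nbhs_agree_on N x : nbhs x (agree_on N x).
Proof. by apply/nbhs_shift; exists N. Qed.

Lemma full_shift_compact : compact [set: shift_space].
Proof.
have h (i : int) : compact [set: discrete_topology A].
  by apply: finite_compact; exact: finite_finset.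
have := @tychonoff int (fun=> discrete_topology A) (fun=> setT) h.
by rewrite (_ : mkset _ = setT) //; apply/seteqP; split.
Qed.

(** The shift coded by [w]: the guarded windows of its points spell words whose code
    [k] satisfies [w k]. *)
Definition coded w : set shift_space :=
  [set x | forall i e, guarded x i e -> w (pickle (window x i (e + 10)))].

Lemma coded_closed w : closed (coded w).
Proof.
move=> x cx i e g.
have [y [yw yx]] := cx _ (nbhs_agree_on (absz i + e + 10) x).
have xy j : i <= j < i + e%:Z + 10 -> x j = y j by move=> ij; rewrite yx //; lia.
rewrite (_ : window x i (e + 10) = window y i (e + 10)); last first.
  by apply: window_eq => j ?; apply: xy; lia.
by apply: yw; exact: guarded_local xy g.
Qed.

Lemma guarded_ends x i e : guarded x i e -> x i = a1 /\ x (i + e%:Z + 9) = a1.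
Proof.
by case=> _ b _ h _; split => //; apply: (frame_one (bracket_frame b)); lia.
Qed.

(** The constant sequence [a0] has no guarded window. *)
Lemma coded_blank w : coded w (fun=> a0).
Proof. by move=> i e /guarded_ends[] /eqP; rewrite (negbTE a01). Qed.

Lemma coded_translate w a x : coded w x -> coded w (translate a x).
Proof.
by move=> xw i e /guarded_translate g; rewrite window_translate; exact: xw.
Qed.

(** The coded shift as a point of the hyperspace. *)
Definition coded_system w : hyperspace shift_space :=
  Hyperspace (coded_closed (w := w)) (ex_intro _ _ (coded_blank w)).

Lemma coded_symbolic w : symbolic_system (coded_system w).
Proof.
apply/seteqP; split=> [_ [x xw <-]|x xw]; first exact: (@coded_translate w 1 x xw).
exists (translate (-1) x); first exact: coded_translate.
by apply/funext => n; rewrite /shift_map /translate addrK.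
Qed.

Lemma iter_shift_map j x n : iter j (@shift_map A) x n = x (n + j%:Z).
Proof.
by elim: j n => [|j ih] n; rewrite ?addr0 //= /shift_map ih; congr x; lia.
Qed.

Lemma shift_dist_le N x y (e : R) : 0 <= e -> 2 ^- N <= e -> agree_on N x y ->
  shift_dist R x y <= e.
Proof.
move=> e0 Ne xy; rewrite /shift_dist; set E := (X in sup X).
have [->|/set0P E0] := eqVneq E set0; first by rewrite sup0.
apply: ge_sup => // _ [n /= xyn <-]; apply: le_trans Ne.
rewrite lef_pV2 ?posrE ?exprn_gt0 //; apply: ler_weXn2l; first by lra.
by rewrite leqNgt; apply/negP => /xy/esym.
Qed.

(** The pieces, enlarged by [N] cells on both sides, are put in a sequence of [a0].
    A guarded window starts and ends with [a1], so both ends lie in pieces; the ends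
    of two distinct pieces are separated by six [a0], so the window lies in one
    piece. *)
Lemma coded_specification w :
  specification (@shift_dist R A) (coded_system w) (@shift_map A).
Proof.
move=> eps eps0.
have [N Neps] := pow2_small eps0.
exists (2 * N + 6)%N => n x a b _ xw ab ba.
have order i i' : (i < i')%N -> (i' < n)%N -> (b i + (2 * N + 6) <= a i')%N.
  elim: i' => // i' ih; rewrite ltnS leq_eqVlt => /orP[/eqP ->|ii'] i'n; first exact: ba.
  have := ih ii' (ltnW i'n); have := ba _ i'n; have := ab i' (ltnW i'n); lia.
pose I i (j : int) := ((a i)%:Z - N%:Z <= j) && (j < (b i)%:Z + N%:Z).
have I_uniq i i' j : (i < n)%N -> (i' < n)%N -> I i j -> I i' j -> i = i'.
  move=> i_n i'n /andP[? ?] /andP[? ?]; case: (ltngtP i i') => // ii'.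
    by have := order _ _ ii' i'n; lia.
  by have := order _ _ ii' i_n; lia.
pose y : shift_space := fun j => if [pick i : 'I_n | I i j] is Some i then x i j else a0.
have yE i j : (i < n)%N -> I i j -> y j = x i j.
  move=> i_n Iij; rewrite /y; case: pickP => [i' Ii'j|/(_ (Ordinal i_n))]; last by rewrite Iij.
  by rewrite (I_uniq _ _ _ i_n (ltn_ord i') Iij Ii'j).
have y0 j : (forall i, (i < n)%N -> ~~ I i j) -> y j = a0.
  by move=> h; rewrite /y; case: pickP => // i; rewrite (negbTE (h i (ltn_ord i))).
have y1 j : y j = a1 -> exists2 i, (i < n)%N & I i j.
  rewrite /y; case: pickP => [i Iij _|_ /eqP]; first by exists i.
  by rewrite (negbTE a01).
exists y.
  move=> p e g; have [/y1[i i_n Ip] /y1[i' i'n Iq]] := guarded_ends g.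
  have /andP[p1 p2] := Ip; have /andP[q1 q2] := Iq.
  case: (ltngtP i i') => ii'.
  (* The six cells from [b i + N] on are [a0] and lie inside the window. *)
  - case: g => _ _ _ _ [_ /(_ ((b i)%:Z + N%:Z))]; have o := order _ _ ii' i'n.
    move=> /(_ ltac:(lia) ltac:(lia)) /negP[]; apply/forallP => o6; have := ltn_ord o6 => h6.
    apply/eqP; apply: y0 => i'' i''n; apply/negP => /andP[h1 h2].
    case: (leqP i'' i) => i3; last by have := order _ _ i3 i''n; lia.
    have : (b i'' <= b i)%N; last by lia.
    move: i3; rewrite leq_eqVlt => /orP[/eqP -> //|i3].
    by have := order _ _ i3 i_n; have := ab i i_n; lia.
  - by have := order _ _ ii' i_n; lia.
  - subst i'; have xy j : p <= j < p + e%:Z + 10 -> y j = x i j.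
      by move=> pj; apply: yE => //; apply/andP; lia.
    rewrite (_ : window y p (e + 10) = window (x i) p (e + 10)); last first.
      by apply: window_eq => j ?; apply: xy; lia.
    by apply: (xw i i_n); exact: guarded_local xy g.
move=> i j i_n aj; apply: (shift_dist_le (ltW eps0) Neps) => m mN.
by rewrite !iter_shift_map; apply: yE => //; apply/andP; lia.
Qed.

(** The coded shift as a point of the space of systems with specification. *)
Definition coded_spec w : spec_systems R A :=
  exist _ (coded_system w)
    (mem_set (conj (coded_symbolic w) (coded_specification w))).

(** The permutation of the codes induced by [toggle_word k] on guarded words; the
    other codes are fixed. *)
Definition code_perm (k : 'I_3) (n : nat) : nat :=
  if @pickle_inv (seq A) n is Some p then
    if `[< guarded_word a0 a1 p >] then pickle (toggle_word a0 a1 k p) else n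
  else n.

Lemma code_perm_guarded k p : guarded_word a0 a1 p ->
  code_perm k (pickle p) = pickle (toggle_word a0 a1 k p).
Proof. by move=> g; rewrite /code_perm pickleK_inv; case: asboolP. Qed.

Lemma code_perm_fix k n : (forall p, guarded_word a0 a1 p -> n <> pickle p) ->
  code_perm k n = n.
Proof.
move=> h; rewrite /code_perm; have := @pickle_invK (seq A) n.
by case: pickle_inv => //= p pn; case: asboolP => // /h; rewrite pn.
Qed.

Lemma code_permK k : involutive (code_perm k).
Proof.
move=> n; have [[p g ->]|h] := pselect (exists2 p, guarded_word a0 a1 p & n = pickle p).
  rewrite !code_perm_guarded //; last exact: guarded_toggle_word.
  by rewrite toggle_wordK.
by rewrite !code_perm_fix // => p g np; apply: h; exists p.
Qed.

Lemma coded_toggle k w x : coded (w \o code_perm k) x -> coded w (toggle k x).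
Proof.
move=> xw i e g; have g' := guarded_toggle a01 k g; rewrite toggleK // in g'.
have /= := xw _ _ g'; rewrite code_perm_guarded; last exact/guarded_window.
by rewrite -window_toggle.
Qed.

Lemma toggle_continuous k : continuous (toggle k : shift_space -> shift_space).
Proof.
move=> x U /nbhs_shift[N NU]; apply/nbhs_shift; exists (N + 27)%N => y yx.
apply: NU => j jN; have k3 := ltn_ord k.
have E i : (absz i < N + 27)%N -> y i = x i by exact: yx.
rewrite /toggle E; last by lia.
rewrite (@toggled_local _ a0 a1 k y x) // => m ?; apply: E; lia.
Qed.

(** [toggle k] is a conjugacy between the two coded shifts. *)
Lemma conjugacy_coded k w :
  conjugacy R A (coded_spec w) (coded_spec (w \o code_perm k)).
Proof.
have wk : w = (w \o code_perm k) \o code_perm k.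
  by apply/funext => n /=; rewrite code_permK.
exists (toggle k); split; last first.
  by move=> x _; exact: (toggle_translate a0 a1 k 1).
split; [|split].
- split.
  + by move=> x xw; apply: coded_toggle; rewrite -wk.
  + by move=> x y _ _ /(congr1 (toggle k)); rewrite !toggleK.
  + move=> x xw; exists (toggle k x); last by rewrite toggleK.
    exact: coded_toggle.
- exact/continuous_subspaceT/toggle_continuous.
- exists (toggle k); split; first exact/continuous_subspaceT/toggle_continuous.
  by move=> x _; rewrite toggleK.
Qed.

(** The coded shift determines [w] on the codes of guarded words. *)
Lemma coded_extend w p : guarded_word a0 a1 p ->
  coded w (extend a0 p) <-> w (pickle p).
Proof.
move=> g; split=> [h|wp i e g']; last by rewrite (guarded_extend a01 g g').
have [e sp g'] := g.
by have := h _ _ g'; rewrite -sp window_extend.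
Qed.

(** One of the two halves of Vietoris continuity. A point of [U] may be replaced by
    [a0] far from the origin without creating guarded windows; then only finitely
    many codes matter. *)
Lemma coded_meets_open w (U : set shift_space) : open U -> coded w `&` U !=set0 ->
  exists K, forall w', agree K w w' -> coded w' `&` U !=set0.
Proof.
move=> oU [x [xw Ux]].
have /nbhs_shift[N NU] : nbhs x U by exact: open_nbhs_nbhs.
pose y : shift_space := fun j => if (absz j < N)%N then x j else a0.
have y1 j : y j = a1 -> (absz j < N)%N.
  by rewrite /y; case: ifP => // _ /eqP; rewrite (negbTE a01).
pose G (m l : nat) := pickle (window y (m%:Z - N%:Z) (l + 10)).
exists (\max_(m < 2 * N) \max_(l < 2 * N) G m l).+1.
move=> w' ww'; exists y; split; last by apply: NU => j jN; rewrite /y jN.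
move=> i e g; have [/y1 iN /y1 eN] := guarded_ends g.
have xy j : i <= j < i + e%:Z + 10 -> y j = x j.
  by move=> ij; rewrite /y ifT //; lia.
have iN' : (absz (i + N%:Z)%R < 2 * N)%N by lia.
have eN' : (e < 2 * N)%N by lia.
rewrite ww'.
  rewrite (@window_eq _ y x); last by move=> j ?; apply: xy; lia.
  by apply: xw; exact: guarded_local xy g.
rewrite ltnS (_ : i = (absz (i + N%:Z))%:Z - N%:Z :> int); last by lia.
apply: leq_trans (@leq_bigmax _ (fun m : 'I_(2 * N) => \max_(l < 2 * N) G m l) (Ordinal iN')).
exact: (@leq_bigmax _ (fun l : 'I_(2 * N) => G _ l) (Ordinal eN')).
Qed.

(** The other half, by compactness: points outside [U] of coded shifts whose codes
    agree with [w] further and further accumulate at a point of [coded w] outside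
    [U]. *)
Lemma coded_sub_open w (U : set shift_space) : open U -> coded w `<=` U ->
  exists K, forall w', agree K w w' -> coded w' `<=` U.
Proof.
move=> oU wU; apply: contrapT => h.
have /choice[u hu] : forall K : nat, exists p : coins * shift_space,
    [/\ agree K w p.1, coded p.1 p.2 & ~ U p.2].
  move=> K; apply: contrapT => h'; apply: h; exists K => w' ww' x xw'.
  by apply: contrapT => nU; apply: h'; exists (w', x).
pose F := (fun K => (u K).2) @ \oo.
have [x [_ Fx]] : [set: shift_space] `&` cluster F !=set0.
  by apply: full_shift_compact; exact: filterT.
have [] : coded w x /\ ~ U x; last by move=> /wU.
split.
  move=> i e g; pose N := (absz i + e + 10)%N; pose p := pickle (window x i (e + 10)).
  have [||y [[K pK yK] yx]] := Fx [set y | exists2 K, (p < K)%N & y = (u K).2] (agree_on N x).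
    by exists p.+1 => // K /= pK; exists K.
    exact: nbhs_agree_on.
  have [uw cu _] := hu K; rewrite -yK in cu.
  have xy j : i <= j < i + e%:Z + 10 -> x j = y j by move=> ij; rewrite yx // /N; lia.
  rewrite -uw // /p (@window_eq _ x y); last by move=> j ?; apply: xy; lia.
  by apply: cu; exact: guarded_local xy g.
move=> Ux; have [||y [nU Uy]] := Fx (~` U) U => //.
  by exists 0%N => // K _ /=; have [] := hu K.
exact: open_nbhs_nbhs.
Qed.

Lemma coded_system_continuous : continuous (coded_system : cantor_space -> _).
Proof.
move=> w U [] P [] [] Q QfinP <- [] V JV Vpz sU.
apply: filterS (_ : nbhs w (coded_system @^-1` V)) => [y Vy|]; first by apply: sU; exists V.
have [L Lsub VL] := QfinP _ JV; rewrite -VL preimage_bigcap.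
apply: filter_bigI => i Li; have /set_mem oi := Lsub _ Li.
have : vietoris_subbase i (coded_system w).
  by move: Vpz; rewrite -VL => /(_ i); apply.
case: i oi {Li} => [[] W] /= oW h; apply/nbhs_cantor.
  have [K hK] := coded_sub_open oW h; exists K => w' ww'; exact: hK.
by have [K hK] := coded_meets_open oW h; exists K => w' ww'; exact: hK.
Qed.

Lemma coded_spec_continuous : continuous (coded_spec : cantor_space -> _).
Proof.
apply: continuous_comp_initial.
rewrite (_ : _ \o _ = coded_system); first exact: coded_system_continuous.
by apply/funext => w; rewrite /= set_valE.
Qed.

End CodedShift.

(** * The action on codes and the conjugacy relation *)

Lemma borel_preimage (T U : topologicalType) (f : T -> U) (B : set U) :
  continuous f -> borel B -> borel (f @^-1` B).
Proof.
move=> cf.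
have sub : @open U `<=` image_set_system setT f (@borel T).
  move=> V oV; apply: sub_sigma_algebra; rewrite setTI.
  by apply: open_comp => // x _; exact: cf.
have sa : sigma_algebra setT (image_set_system setT f (@borel T)).
  by apply: sigma_algebra_image; exact: smallest_sigma_algebra.
move=> bB; have := smallest_sub sa sub bB.
by rewrite /image_set_system /= setTI.
Qed.

Section CodeAction.
Variables (R : realType) (A : finType) (a0 a1 : A).
Hypothesis a01 : a0 != a1.
Local Notation perm_code := (code_perm a0 a1).
Local Notation act := (word_act perm_code).
Local Notation spec := (coded_spec R a01).

Lemma word_act_continuous (w : seq 'I_3) : continuous (act w : cantor_space -> cantor_space).
Proof.
move=> x U /nbhs_cantor[n nU]; apply/nbhs_cantor.
exists (\max_(k < n) word_index perm_code w k).+1 => y yx; apply: nU => k kn.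
rewrite !word_actE /= yx // ltnS.
exact: (@leq_bigmax _ (fun k : 'I_n => word_index perm_code w k) (Ordinal kn)).
Qed.

Lemma word_act_pair_continuous w :
  continuous (fun x : cantor_space => (spec x, spec (act w x))).
Proof.
move=> x U [[V W] /= [nV nW] VW].
have h1 : nbhs x (spec @^-1` V) := coded_spec_continuous nV.
have h2 : nbhs x ((spec \o act w) @^-1` W) := word_act_continuous (coded_spec_continuous nW).
have FF := @nbhs_filter cantor_space x.
apply: (@filterS _ _ FF _ _ _ (@filterI _ _ FF _ _ h1 h2)) => y [Vy Wy].
exact: VW.
Qed.

(** A reduced word acts on stacks by pushing its letters, the first letter of [w]
    first. *)
Lemma word_index_stack u w n :
  reduced (u ++ w) -> ((size (u ++ w)).+1 < n)%N ->
  word_index perm_code w (pickle (stack_word a0 a1 u n)) = pickle (stack_word a0 a1 (u ++ w) n).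
Proof.
elim: w u => [|s w ih] u; first by rewrite cats0.
rewrite -cat_rcons => ruw sn /=.
have su : ((size u).+1 < n)%N by move: sn; rewrite size_cat size_rcons; lia.
rewrite code_perm_guarded; last exact: stack_word_guarded.
rewrite stack_word_toggle //; first exact: ih.
case: (lastP u) ruw => [|v t] ruw; first by have := ltn_ord s => /=; lia.
rewrite map_rcons size_rcons nth_rcons size_map ltnn eqxx.
move: ruw; rewrite /reduced; case: v => [|b v] /=.
  by move=> /andP[ts _]; apply: contraNneq ts => ts; apply/eqP/val_inj.
rewrite cat_path !rcons_path last_rcons => /andP[/andP[_ ts] _].
by apply: contraNneq ts => ts; apply/eqP/val_inj.
Qed.

Lemma size_stack_word w n : size (stack_word a0 a1 w n) = (9 * n.+1 + 10)%N.
Proof. by rewrite size_mkseq. Qed.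

(** A nonempty reduced word moves the code of the empty stack with [n] places, for
    each large [n], to the code of another word of the same length. Infinitely many
    disjoint pairs of coordinates have to agree at a fixed point. *)
Lemma word_act_free w : reduced w -> w <> [::] ->
  (coin_measure R).-negligible [set x | act w x = x].
Proof.
move=> rw wn; pose m j := ((size w).+2 + j)%N.
pose p j := pickle (stack_word a0 a1 [::] (m j)).
pose q j := pickle (stack_word a0 a1 w (m j)).
have pickle_size u v i j :
    pickle (stack_word a0 a1 u (m i)) = pickle (stack_word a0 a1 v (m j)) -> i = j.
  move=> /(pcan_inj pickleK) /(congr1 size); rewrite !size_stack_word /m; lia.
have pq i j : p i <> q j.
  move=> e; have ij := pickle_size _ _ _ _ e; move: e => /(pcan_inj pickleK); rewrite ij.
  case: w wn @m @p @q {rw pickle_size} => // s w _ m _ _ /esym.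
  by apply: stack_word_neq => //; rewrite /m; lia.
apply: negligibleS (@coin_measure_matching0 R p q _ _ pq) => [x xw j|i j|i j].
- have -> : q j = word_index perm_code w (p j).
    by rewrite word_index_stack //= /m; lia.
  by rewrite -[in LHS]xw word_actE.
- exact: pickle_size.
- exact: pickle_size.
Qed.

Lemma word_index_fix w n : (forall p, guarded_word a0 a1 p -> n <> pickle p) ->
  word_index perm_code w n = n.
Proof. by move=> h; elim: w => //= s w ih; rewrite code_perm_fix. Qed.

(** Points of one orbit differ only at codes of guarded words, hence are separated by
    their coded shifts. *)
Lemma coded_spec_inj_orbit w v x : spec (act w x) = spec (act v x) -> act w x = act v x.
Proof.
move=> /(congr1 (fun Y : spec_systems R A => hset (set_val Y))).
rewrite !set_valE /= => e; apply/funext => n.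
have [[p g ->]|h] := pselect (exists2 p, guarded_word a0 a1 p & n = pickle p).
  have := coded_extend a01 (act w x) g; have := coded_extend a01 (act v x) g.
  by rewrite e => h1 h2; apply/idP/idP => h; [apply/h1/h2|apply/h2/h1].
by rewrite !word_actE /= !word_index_fix // => p g np; apply: h; exists p.
Qed.

Lemma conjugacy_not_hyperfinite : ~ hyperfinite (conjugacy R A).
Proof.
move=> [F [Fb Ff Fs FE]].
apply: (@action_not_hyperfinite R perm_code _ _ (fun n x y => F n (spec x) (spec y))).
- by move=> k; exact: code_permK.
- exact: word_act_free.
- move=> n; have [_ [Hr Hs Ht]] := Fb n; split.
  + by move=> x; exact: Hr.
  + by move=> x y; exact: Hs.
  + by move=> x y z; exact: Ht.
- move=> n w; have [bF _] := Fb n.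
  exact: (borel_preimage (@word_act_pair_continuous w) bF).
- move=> n x.
  (* [g] inverts [spec] on the orbit of [x], so it carries the finite class of
     [spec x] onto a set that contains the one to be bounded. *)
  have /choice[g hg] : forall Y : spec_systems R A, exists y : coins,
      (exists w, y = act w x /\ spec y = Y) \/ ~ exists w, spec (act w x) = Y.
    move=> Y; have [[w wY]|h] := pselect (exists w, spec (act w x) = Y).
      by exists (act w x); left; exists w.
    by exists x; right.
  apply: sub_finite_set (finite_image g (Ff n (spec x))).
  move=> y [Fy [w yw]]; exists (spec y) => //.
  have [[v [gv sv]]|[]] := hg (spec y); last by exists w; rewrite yw.
  by rewrite gv yw; apply: coded_spec_inj_orbit; rewrite -gv sv yw.
- by move=> n x y; exact: Fs.
- by move=> s x; apply/FE; exact: conjugacy_coded.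
Qed.

End CodeAction.

Theorem corollary5p9 (R : realType) (A : finType) (hA : (2 <= #|A|)%N) :
  ~ hyperfinite (conjugacy R A).
Proof.
have [a0 [a1 [_ _ a01]]] : exists a0 a1 : A, [/\ a0 \in A, a1 \in A & a0 != a1].
  by apply/card_gt1P.
exact: conjugacy_not_hyperfinite a01.
Qed.
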